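(* For each field $k$ and each integer $d\ge 2$, the set of dynamical degrees of all affine-triangular automorphisms of $\mathbb{A}^3=\mathbb{A}^3_k$ of degree $\le d$ is equal to \[ \left\{\frac{a+\sqrt{a^2+4bc}}{2}\ \Big|\ (a,b,c)\in \mathbb{N}^3,\ a+b\le d,\ c\le d\right\}\setminus \{0\}. \] Moreover, for all $a,b,c\in \mathbb{N}$ such that $\lambda=\frac{a+\sqrt{a^2+4bc}}{2}\neq 0$, the dynamical degree of each of the two automorphisms \[ (x_3 + x_1^ax_2^b,\ x_2+x_1^c,\ x_1) \quad\text{and}\quad (x_3+x_1^ax_2^{bc},\ x_1,\ x_2) \] of $\mathbb{A}^3$ is equal to $\lambda$.
   Context: $\mathbb{N}$ contains $0$. An endomorphism of $\mathbb{A}^n=\mathbb{A}^n_k$ is a tuple $f=(f_1,\ldots,f_n)\in k[x_1,\ldots,x_n]^n$, viewed as the map $(x_1,\ldots,x_n)\mapsto(f_1,\ldots,f_n)$; composition is $(f\circ g)_i=f_i(g_1,\ldots,g_n)$, and $f^r$ is the $r$-fold iterate. $\mathrm{End}(\mathbb{A}^n)$ is the monoid of endomorphisms and $\mathrm{Aut}(\mathbb{A}^n)$ its group of invertible elements. The degree is $\deg(f)=\max_i \deg(f_i)$. For dominant $f$ the dynamical degree is $\lambda(f)=\lim_{r\to\infty}\deg(f^r)^{1/r}\in\mathbb{R}_{\ge1}$ (the limit exists). An affine automorphism is an automorphism of degree $1$; $\tau\in\mathrm{End}(\mathbb{A}^n)$ is triangular if $\tau_i\in k[x_1,\ldots,x_i]$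 for each $i$. An endomorphism is affine-triangular if it is of the form $\alpha\circ\tau$ with $\alpha$ an affine automorphism and $\tau$ a triangular endomorphism. *)

(* Defs.v *)
(* mpoly must be imported before the analysis files: in the other order their
   notation levels clash. *)
From mathcomp Require Export all_boot all_order all_algebra.
From mathcomp Require Export mpoly.
From mathcomp Require Export all_classical all_reals all_analysis.
Import Order.TTheory GRing.Theory Num.Theory.
Import numFieldNormedType.Exports.

Set Implicit Arguments.
Unset Strict Implicit.
Unset Printing Implicit Defensive.

Local Open Scope classical_set_scope.
Local Open Scope ring_scope.

(* Coordinates are numbered from 0: 'X_i stands for the usual x_(i+1). *)
Notation endo k n := (n.-tuple {mpoly k[n]}).

Section Endomorphisms.
Variables (k : fieldType) (n : nat).
Implicit Types f g : endo k n.

Definition endo_id : endo k n := [tuple 'X_i | i < n].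

Definition endo_comp f g : endo k n := [tuple tnth f i \mPo g | i < n].

Definition endo_iter (r : nat) f : endo k n := iter r (endo_comp f) endo_id.

Definition is_automorphism f : Prop :=
  exists g, endo_comp f g = endo_id /\ endo_comp g f = endo_id.

(* msize p is 1 + deg p for p != 0 and 0 for p = 0, so a zero component counts
   as having degree 0; this does not affect the maximum unless f = 0. *)
Definition degree f : nat := \max_(i < n) (msize (tnth f i)).-1.

Definition is_affine_automorphism f : Prop :=
  is_automorphism f /\ degree f = 1%N.

(* The i-th component only involves the variables of index at most i. *)
Definition is_triangular f : Prop :=
  forall (i : 'I_n) (m : 'X_{1..n}), m \in msupp (tnth f i) ->
  forall j : 'I_n, (i < j)%N -> m j = 0%N.

Definition is_affine_triangular f : Prop :=
  exists alpha tau : endo k n,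
    [/\ is_affine_automorphism alpha, is_triangular tau
      & f = endo_comp alpha tau].

(* lim is total, with value 0 on a divergent real sequence; for dominant f the
   sequence converges and its limit is at least 1. *)
Definition dynamical_degree (R : realType) f : R :=
  lim ((fun r : nat => (degree (endo_iter r f))%:R `^ (r%:R)^-1 : R) @ \oo).

End Endomorphisms.

Definition quadratic_value (R : realType) (a b c : nat) : R :=
  (a%:R + Num.sqrt (a%:R ^+ 2 + 4 * b%:R * c%:R)) / 2.

Section ThreeSpace.
Variable k : fieldType.

Definition coord (i : nat) : {mpoly k[3]} := 'X_(inord i).

Local Notation x1 := (coord 0).
Local Notation x2 := (coord 1).
Local Notation x3 := (coord 2).

Definition first_automorphism (a b c : nat) : endo k 3 :=
  [tuple x3 + x1 ^+ a * x2 ^+ b; x2 + x1 ^+ c; x1].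

Definition second_automorphism (a b c : nat) : endo k 3 :=
  [tuple x3 + x1 ^+ a * x2 ^+ (b * c); x1; x2].

End ThreeSpace.

(* Main.v *)
(* The dynamical degree is read off from weights mu on the variables: if every component f_i
   has mu-degree at most th mu_i, then deg f^r = O(th^r), and the bound is sharp as soon as the
   iterates of the mu-leading part g of f do not vanish. The latter is automatic when g is
   dominant, since g then acts injectively on polynomials; this handles all the ties between
   monomials of maximal weight, in every characteristic.

   By the Bruhat decomposition of affine groups, an affine-triangular automorphism is affinely
   conjugate to s o (x1 + const, x2 + p(x1), x3 + q(x1,x2)), up to nonzero scalars, with s one of
   the six permutations of the coordinates. In each case th is the largest root of
   th^2 = a th + b c over the monomials x1^a x2^b of a suitable polynomial. For the transposition
   of x1 and x3 this polynomial is q, c = deg p, and mu = (th, c, 1). For the two 3-cycles a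
   polynomial conjugation leads to (x3 + Q(x1,x2), x1, x2), with c = 1 and mu = (th^2, th, 1). *)

Require Import Defs.
Import Order.TTheory GRing.Theory Num.Theory.
Import numFieldNormedType.Exports.
From mathcomp Require Import fingroup perm ring lra zify.

Set Implicit Arguments.
Unset Strict Implicit.
Unset Printing Implicit Defensive.

Local Open Scope classical_set_scope.
Local Open Scope ring_scope.

(** The delicate point is the bound on a, b, c rather than the value of the dynamical degree. For
    one of the two 3-cycles the conjugation substitutes p into q, so the degree of Q may exceed d by
    far and the exponents of its dominant monomial need not satisfy a + b <= d. With e = deg p, one
    compares th and e: for th > e a monomial of q itself has the required weight, and for th < e the
    cancellations that Q must undergo force e^2 <= d. The second obstacle is that weights degenerate
    when one coordinate evolves by itself: its natural weight is then 0, which is enough for a lower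
    bound on degrees but not for an upper one. Growth is therefore measured from above only by the
    powers of every t > th. Leading parts are taken at a prescribed level and may be 0, so that they
    add, multiply and compose without side conditions. Nonvanishing is examined only for the
    iterates of the leading map, through algebraic independence of its components, since a Jacobian
    criterion would fail in positive characteristic. *)

Section Support.
Variables (k : fieldType) (n : nat).
Implicit Types (p q : {mpoly k[n]}) (P Q S : 'X_{1..n} -> Prop).

(** Bounds on degrees, on weights and on the variables that occur are all conditions on monomials,
    so their closure properties are proved once for an arbitrary predicate. *)
Definition supp_in P p : Prop := forall m, m \in msupp p -> P m.

Lemma supp_inW P Q p : (forall m, P m -> Q m) -> supp_in P p -> supp_in Q p.
Proof. by move=> PQ Pp m /Pp /PQ. Qed.

Lemma supp_in0 P : supp_in P (0 : {mpoly k[n]}).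
Proof. by move=> m; rewrite msupp0. Qed.

Lemma supp_inD P p q : supp_in P p -> supp_in P q -> supp_in P (p + q).
Proof.
by move=> Pp Pq m /msuppD_le; rewrite mem_cat => /orP[/Pp|/Pq].
Qed.

Lemma supp_inN P p : supp_in P p -> supp_in P (- p).
Proof. by move=> Pp m; rewrite (perm_mem (msuppN p)) => /Pp. Qed.

Lemma supp_inB P p q : supp_in P p -> supp_in P q -> supp_in P (p - q).
Proof. by move=> Pp Pq; apply: supp_inD => //; apply: supp_inN. Qed.

Lemma supp_inZ P (c : k) p : supp_in P p -> supp_in P (c *: p).
Proof. by move=> Pp m /msuppZ_le /Pp. Qed.

Lemma supp_in_sum (I : eqType) P (r : seq I) (b : pred I) (F : I -> {mpoly k[n]}) :
  (forall i, i \in r -> b i -> supp_in P (F i)) -> supp_in P (\sum_(i <- r | b i) F i).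
Proof.
move=> PF; rewrite big_seq_cond; elim/big_ind: _ => [|p q|i /andP[ri bi]].
- exact: supp_in0.
- exact: supp_inD.
- exact: PF.
Qed.

Lemma supp_inX P m : P m -> supp_in P ('X_[m] : {mpoly k[n]}).
Proof. by move=> Pm m' /mem_msuppXP <-. Qed.

Lemma supp_inC P (c : k) : P 0%MM -> supp_in P (c%:MP_[n]).
Proof. by move=> P0 m; rewrite msuppC; case: ifP => // _; rewrite inE => /eqP ->. Qed.

Lemma supp_inM P Q S p q : (forall m1 m2, P m1 -> Q m2 -> S (m1 + m2)%MM) ->
  supp_in P p -> supp_in Q q -> supp_in S (p * q).
Proof.
move=> PQS Pp Qq m /msuppM_le /allpairsP[[m1 m2] /= [h1 h2 ->]].
by apply: PQS; [apply: Pp|apply: Qq].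
Qed.

End Support.

(** * Weighted degrees and leading parts *)

Section WeightedDegree.
Variables (R : realFieldType) (k : fieldType) (n : nat).
Implicit Types (p q h : {mpoly k[n]}) (mu : 'I_n -> R) (D : R).

Definition wdeg mu (m : 'X_{1..n}) : R := \sum_i mu i * (m i)%:R.

Lemma wdeg0 mu : wdeg mu 0%MM = 0.
Proof. by rewrite /wdeg big1 // => i _; rewrite mnm0E mulr0. Qed.

Lemma wdegD mu m1 m2 : wdeg mu (m1 + m2)%MM = wdeg mu m1 + wdeg mu m2.
Proof.
rewrite /wdeg -big_split /=; apply: eq_bigr => i _.
by rewrite mnmDE natrD mulrDr.
Qed.

Lemma wdeg1 mu i : wdeg mu U_(i)%MM = mu i.
Proof.
rewrite /wdeg (bigD1 i) //= mnm1E eqxx mulr1 big1 ?addr0 // => j ji.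
by rewrite mnm1E eq_sym (negbTE ji) mulr0.
Qed.

Lemma wdegZ mu c m : wdeg (fun i => c * mu i) m = c * wdeg mu m.
Proof. by rewrite /wdeg mulr_sumr; apply: eq_bigr => i _; rewrite mulrA. Qed.

Lemma wdeg_indicator j m : wdeg (fun i => (i == j)%:R) m = (m j)%:R.
Proof.
rewrite /wdeg (bigD1 j) //= eqxx mul1r big1 ?addr0 // => i ij.
by rewrite (negbTE ij) mul0r.
Qed.

Lemma wdeg_mdeg m : wdeg (fun=> 1) m = (mdeg m)%:R.
Proof. by rewrite /wdeg mdegE natr_sum; apply: eq_bigr => i _; rewrite mul1r. Qed.

(** As conditions on the support, these hold for the zero polynomial at every level, so no
    convention for its degree is needed. *)
Definition wle mu D p := supp_in (fun m => wdeg mu m <= D) p.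
Definition wlt mu D p := supp_in (fun m => wdeg mu m < D) p.
Definition whomog mu D p := supp_in (fun m => wdeg mu m = D) p.

(* h is the part of p of degree D, and nothing in p exceeds degree D; h may be 0 *)
Definition lead_at mu D p h := whomog mu D h /\ wlt mu D (p - h).

Definition wpart mu D p := \sum_(m <- msupp p | wdeg mu m == D) p@_m *: 'X_[m].

Lemma whomog_wle mu D p : whomog mu D p -> wle mu D p.
Proof. by apply: supp_inW => m ->. Qed.

Lemma wlt_wle mu D p : wlt mu D p -> wle mu D p.
Proof. by apply: supp_inW => m /ltW. Qed.

Lemma lead_at_wle mu D p h : lead_at mu D p h -> wle mu D p.
Proof.
case=> hh ph; rewrite -[p](subrK h).
by apply: supp_inD; [apply: wlt_wle|apply: whomog_wle].
Qed.

Lemma lead_at_homog mu D h : whomog mu D h -> lead_at mu D h h.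
Proof. by move=> hh; split=> //; rewrite subrr; apply: supp_in0. Qed.

Lemma lead_at_lt mu D p : wlt mu D p -> lead_at mu D p 0.
Proof. by move=> pD; split; [apply: supp_in0|rewrite subr0]. Qed.

Lemma lead_at0 mu D : lead_at mu D 0 0.
Proof. by apply: lead_at_lt; apply: supp_in0. Qed.

Lemma lead_atD mu D p q h g :
  lead_at mu D p h -> lead_at mu D q g -> lead_at mu D (p + q) (h + g).
Proof.
move=> [hh ph] [hg qg]; split; first exact: supp_inD.
by rewrite opprD addrACA; apply: supp_inD.
Qed.

Lemma lead_atZ mu D c p h : lead_at mu D p h -> lead_at mu D (c *: p) (c *: h).
Proof. by move=> [hh ph]; split; [|rewrite -scalerBr]; apply: supp_inZ. Qed.

Lemma lead_at_sum (I : eqType) mu D (r : seq I) (F G : I -> {mpoly k[n]}) :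
  (forall i, i \in r -> lead_at mu D (F i) (G i)) ->
  lead_at mu D (\sum_(i <- r) F i) (\sum_(i <- r) G i).
Proof.
elim: r => [|i r IH] FG; first by rewrite !big_nil; apply: lead_at0.
rewrite !big_cons; apply: lead_atD; first by apply: FG; rewrite mem_head.
by apply: IH => j jr; apply: FG; rewrite inE jr orbT.
Qed.

Lemma lead_atM mu D E p q h g :
  lead_at mu D p h -> lead_at mu E q g -> lead_at mu (D + E) (p * q) (h * g).
Proof.
move=> lp lq; have [hh ph] := lp; have [hg qg] := lq; split.
  by apply: supp_inM hh hg => m1 m2 /= <- <-; apply: wdegD.
have -> : p * q - h * g = (p - h) * q + h * (q - g) by ring.
apply: supp_inD.
  apply: supp_inM ph (lead_at_wle lq) => m1 m2 /= ? ?.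
  by rewrite wdegD ltr_leD.
apply: supp_inM (whomog_wle hh) qg => m1 m2 /= ? ?.
by rewrite wdegD ler_ltD.
Qed.

Lemma lead_at1 mu : lead_at mu 0 1 1.
Proof. by apply: lead_at_homog => m; rewrite -mpolyC1 => /(@supp_inC _ _ (eq^~ 0%MM)) -> //; apply: wdeg0. Qed.

Lemma lead_atX mu D p h e :
  lead_at mu D p h -> lead_at mu (D * e%:R) (p ^+ e) (h ^+ e).
Proof.
move=> lp; elim: e => [|e IH]; first by rewrite mulr0; apply: lead_at1.
by rewrite !exprS -natr1 mulrDr mulr1 addrC; apply: lead_atM.
Qed.

Lemma lead_at_prod mu (I : finType) (D : I -> R) (F G : I -> {mpoly k[n]}) :
  (forall i, lead_at mu (D i) (F i) (G i)) ->
  lead_at mu (\sum_i D i) (\prod_i F i) (\prod_i G i).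
Proof.
move=> FG; elim/big_rec3: _ => [|i x y z _ IH]; first exact: lead_at1.
exact: lead_atM.
Qed.

Lemma lead_at_var mu i : lead_at mu (mu i) ('X_i : {mpoly k[n]}) 'X_i.
Proof. by apply: lead_at_homog; apply: supp_inX; rewrite wdeg1. Qed.

Lemma lead_atW mu D E p : wle mu D p -> D < E -> lead_at mu E p 0.
Proof.
move=> pD DE; apply: lead_at_lt; apply: supp_inW pD => m /= h.
exact: le_lt_trans h DE.
Qed.

Lemma mcoeff_wpart mu D p m : (wpart mu D p)@_m = if wdeg mu m == D then p@_m else 0.
Proof.
rewrite /wpart raddf_sum /=.
under eq_bigr => i _ do rewrite mcoeffZ mcoeffX.
have [mp|mp] := boolP (m \in msupp p); last first.
  rewrite (memN_msupp_eq0 mp) if_same big_seq_cond big1 // => i /andP[ip _].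
  case: eqP => [E|]; last by rewrite mulr0.
  by rewrite -E ip in mp.
rewrite big_mkcond (bigD1_seq m) //= eqxx mulr1 big1 ?addr0 // => i im.
by rewrite (negbTE im) mulr0 if_same.
Qed.

Lemma lead_at_wpart mu D p : wle mu D p -> lead_at mu D p (wpart mu D p).
Proof.
move=> pD; split=> m; rewrite mcoeff_msupp.
  by rewrite mcoeff_wpart; case: (eqVneq (wdeg mu m) D) => //; rewrite eqxx.
rewrite mcoeffB mcoeff_wpart; case: (eqVneq (wdeg mu m) D); first by rewrite subrr eqxx.
rewrite subr0 => ne pm; rewrite lt_neqAle ne /=; apply: pD.
by rewrite mcoeff_msupp.
Qed.

Lemma lead_at_coeff mu D p h m :
  lead_at mu D p h -> h@_m = if wdeg mu m == D then p@_m else 0.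
Proof.
move=> [hh ph]; case: eqP => [E|NE]; last first.
  by apply/eqP; rewrite mcoeff_eq0; apply/negP => /hh.
apply/esym/eqP; rewrite -subr_eq0 -mcoeffB mcoeff_eq0; apply/negP => /ph.
by rewrite E ltxx.
Qed.

Lemma lead_at_wpartE mu D p h : lead_at mu D p h -> h = wpart mu D p.
Proof.
by move=> lp; apply/mpolyP => m; rewrite (lead_at_coeff m lp) mcoeff_wpart.
Qed.

Lemma lead_at_neq0 mu D p h : lead_at mu D p h -> h != 0 -> p != 0.
Proof.
move=> lp; apply: contraNneq => p0; apply/eqP/mpolyP => m.
by rewrite (lead_at_coeff m lp) p0 mcoeff0 if_same.
Qed.

Lemma lead_at_inj mu D E p h g : lead_at mu D p h -> lead_at mu E p g ->
  h != 0 -> g != 0 -> D = E.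
Proof.
move=> lp lq h0 g0.
wlog suff: D E h g lp lq h0 g0 / D <= E.
  by move=> W; apply/eqP; rewrite eq_le (W _ _ _ _ lp lq) ?(W _ _ _ _ lq lp).
case E1 : (msupp h) => [|m s]; first by rewrite (msuppnil0 E1) eqxx in h0.
have mh : m \in msupp h by rewrite E1 mem_head.
rewrite -(lp.1 _ mh); apply: (lead_at_wle lq).
move: mh; rewrite !mcoeff_msupp (lead_at_coeff m lp).
by case: ifP => //; rewrite eqxx.
Qed.

Lemma ex_lead_at mu p : p != 0 -> exists m h,
  [/\ m \in msupp p, h != 0, lead_at mu (wdeg mu m) p h & wle mu (wdeg mu m) p].
Proof.
move=> p0.
have : exists2 m, m \in msupp p & wle mu (wdeg mu m) p.
  rewrite /wle /supp_in; have : msupp p != [::] by rewrite msupp_eq0.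
  elim: (msupp p) => // a [|b s] IH _.
    by exists a; rewrite ?mem_head // => m; rewrite inE => /eqP ->.
  have [|m ms mM] := IH; first by [].
  have [am|am] := leP (wdeg mu a) (wdeg mu m).
    exists m; first by rewrite inE ms orbT.
    by move=> m'; rewrite inE => /orP[/eqP ->|/mM].
  exists a; first exact: mem_head.
  move=> m'; rewrite inE => /orP[/eqP ->|/mM] // h.
  exact: le_trans h (ltW am).
case=> m mp pm; exists m, (wpart mu (wdeg mu m) p); split=> //.
  apply: contraTneq mp => E; have := mcoeff_wpart mu (wdeg mu m) p m.
  by rewrite E mcoeff0 eqxx => /esym /eqP; rewrite mcoeff_eq0.
exact: lead_at_wpart.
Qed.

End WeightedDegree.

Section Composition.
Variables (R : realFieldType) (k : fieldType) (n l : nat).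

(** Substituting [Y] into a monomial of nu-weight w gives a polynomial at mu-level w, with the
    leading part obtained by substituting [H]. The monomials of weight [D] thus contribute exactly
    [g \mPo H], and those of smaller weight contribute 0 at level [D]. The weights may be 0 or
    negative. *)
Lemma lead_at_comp (nu : 'I_n -> R) (mu : 'I_l -> R) D (p g : {mpoly k[n]})
    (Y H : n.-tuple {mpoly k[l]}) :
  lead_at nu D p g -> (forall j, lead_at mu (nu j) (tnth Y j) (tnth H j)) ->
  lead_at mu D (p \mPo Y) (g \mPo H).
Proof.
move=> lp lY; have lm m : lead_at mu (wdeg nu m)
    (\prod_i tnth Y i ^+ m i) (\prod_i tnth H i ^+ m i).
  by apply: lead_at_prod => i; apply: lead_atX.
rewrite (lead_at_wpartE lp) /wpart raddf_sum /= comp_mpolyEX [X in lead_at _ _ _ X]big_mkcond.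
apply: lead_at_sum => m mp; case: eqP => [<-|/eqP ne].
  by rewrite comp_mpolyZ !comp_mpolyX; apply: lead_atZ.
rewrite comp_mpolyX -[0](scaler0 _ (p@_m)); apply: lead_atZ.
apply: lead_atW (lead_at_wle (lm m)) _.
by rewrite lt_neqAle ne (lead_at_wle lp).
Qed.

Lemma wle_comp (nu : 'I_n -> R) (mu : 'I_l -> R) D (p : {mpoly k[n]})
    (Y : n.-tuple {mpoly k[l]}) :
  wle nu D p -> (forall j, wle mu (nu j) (tnth Y j)) -> wle mu D (p \mPo Y).
Proof.
move=> lp lY; pose H := [tuple wpart mu (nu j) (tnth Y j) | j < n].
apply: (@lead_at_wle _ _ _ _ _ _ (wpart nu D p \mPo H)).
apply: lead_at_comp (lead_at_wpart lp) _ => j.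
by rewrite tnth_mktuple; apply: lead_at_wpart.
Qed.

End Composition.

(** * The monoid of endomorphisms and the degree *)

Section EndoMonoid.
Variables (k : fieldType) (n : nat).
Implicit Types (f g h F G : endo k n) (p : {mpoly k[n]}).

Lemma comp_mpolyA p F G : (p \mPo F) \mPo G = p \mPo endo_comp F G.
Proof.
rewrite [p \mPo F]comp_mpolyEX [RHS]comp_mpolyEX raddf_sum /=; apply: eq_bigr => m _.
rewrite comp_mpolyZ; congr (_ *: _); rewrite !comp_mpolyX rmorph_prod /=.
by apply: eq_bigr => i _; rewrite rmorphXn /= tnth_mktuple.
Qed.

Lemma comp_mpoly_var i F : 'X_i \mPo F = tnth F i.
Proof. by rewrite comp_mpolyXU -tnth_nth. Qed.

Lemma tnth_endo_comp F G i : tnth (endo_comp F G) i = tnth F i \mPo G.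
Proof. by rewrite tnth_mktuple. Qed.

Lemma tnth_endo_id i : tnth (endo_id k n) i = 'X_i.
Proof. by rewrite tnth_mktuple. Qed.

Lemma endo_compA f g h : endo_comp f (endo_comp g h) = endo_comp (endo_comp f g) h.
Proof. by apply: eq_from_tnth => i; rewrite !tnth_endo_comp comp_mpolyA. Qed.

Lemma endo_comp1f f : endo_comp (endo_id k n) f = f.
Proof. by apply: eq_from_tnth => i; rewrite tnth_endo_comp tnth_endo_id comp_mpoly_var. Qed.

Lemma endo_compf1 f : endo_comp f (endo_id k n) = f.
Proof. by apply: eq_from_tnth => i; rewrite tnth_endo_comp comp_mpoly_id. Qed.

Lemma endo_iterS r f : endo_iter r.+1 f = endo_comp f (endo_iter r f).
Proof. by []. Qed.

Lemma is_automorphism_id : is_automorphism (endo_id k n).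
Proof. by exists (endo_id k n); rewrite endo_comp1f. Qed.

Lemma is_automorphism_comp f g :
  is_automorphism f -> is_automorphism g -> is_automorphism (endo_comp f g).
Proof.
move=> [f' [ff' f'f]] [g' [gg' g'g]]; exists (endo_comp g' f'); split.
  by rewrite -endo_compA (endo_compA g) gg' endo_comp1f.
by rewrite -endo_compA (endo_compA f') f'f endo_comp1f.
Qed.

Lemma is_automorphism_iter r f : is_automorphism f -> is_automorphism (endo_iter r f).
Proof.
move=> af; elim: r => [|r IH]; first exact: is_automorphism_id.
exact: is_automorphism_comp.
Qed.

Lemma endo_iter_conj r h h' f : endo_comp h h' = endo_id k n -> endo_comp h' h = endo_id k n ->
  endo_iter r (endo_comp h (endo_comp f h')) =
  endo_comp h (endo_comp (endo_iter r f) h').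
Proof.
move=> hh' h'h; elim: r => [|r IH]; first by rewrite /endo_iter /= endo_comp1f hh'.
rewrite (endo_iterS r f) (endo_iterS r (endo_comp _ _)) IH.
move: (endo_iter r f) => F.
rewrite -(endo_compA h) -(endo_compA f h') (endo_compA h' h) h'h.
rewrite (endo_comp1f (endo_comp F h')) -(endo_compA f F); reflexivity.
Qed.

Lemma mdeg_le_degree f i m : m \in msupp (tnth f i) -> (mdeg m <= degree f)%N.
Proof.
move=> /msize_mdeg_lt h; have := leq_bigmax_cond (F := fun i => (msize (tnth f i)).-1) i isT.
by rewrite -/(degree f); apply: leq_trans; case: (msize _) h.
Qed.

Lemma degree_le f D : (forall i m, m \in msupp (tnth f i) -> (mdeg m <= D)%N) ->
  (degree f <= D)%N.
Proof.
move=> fD; apply/bigmax_leqP => i _; have [->|p0] := eqVneq (tnth f i) 0.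
  by rewrite msize0.
rewrite -(mlead_deg p0) /=; apply: (fD i); exact: mlead_supp.
Qed.

(** The ordinary degree is the weight with all mu_i = 1, so this is an instance of [wle_comp]. Since
    the monomial order refines the degree, [mlead p] can serve as m' for every m. *)
Lemma mdeg_comp p F m : m \in msupp (p \mPo F) ->
  exists2 m', m' \in msupp p & (mdeg m <= mdeg m' * degree F)%N.
Proof.
move=> mp; have p0 : p != 0 by apply: contraTneq mp => ->; rewrite raddf0 msupp0.
have := wle_comp (R := rat) (nu := fun=> (degree F)%:R) (mu := fun=> 1)
  (D := (mdeg (mlead p) * degree F)%:R) (p := p) (Y := F).
move=> /(_ _ _ m mp); rewrite wdeg_mdeg ler_nat => h.
exists (mlead p); first exact: mlead_supp.
apply: h => [m' /= m'p|j m' /= /mdeg_le_degree]; last by rewrite wdeg_mdeg ler_nat.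
have -> : (fun=> (degree F)%:R) = (fun i : 'I_n => (degree F)%:R * 1) :> ('I_n -> rat).
  by apply/funext => i; rewrite mulr1.
rewrite wdegZ wdeg_mdeg -natrM ler_nat mulnC leq_mul2r; apply/orP; right.
exact: lemc_mdeg (msupp_le_mlead m'p).
Qed.

Lemma degree_comp F G : (degree (endo_comp F G) <= degree F * degree G)%N.
Proof.
apply: degree_le => i m; rewrite tnth_endo_comp => /mdeg_comp[m' m'F].
by move=> /leq_trans; apply; rewrite leq_mul2r (mdeg_le_degree m'F) orbT.
Qed.

Lemma degree_automorphism f : (0 < n)%N -> is_automorphism f -> (0 < degree f)%N.
Proof.
move=> n0 [g [fg gf]]; rewrite lt0n; apply/eqP => f0.
have := congr1 (fun F => tnth F (Ordinal n0)) gf; rewrite tnth_endo_comp tnth_endo_id => E.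
have : U_(Ordinal n0)%MM \in msupp (tnth g (Ordinal n0) \mPo f) by rewrite E msuppX mem_head.
by move=> /mdeg_comp[m' _]; rewrite mdeg1 f0 muln0.
Qed.

End EndoMonoid.

(** * Growth of degrees under iteration *)

Section Growth.
Variables (R : realType) (k : fieldType) (n : nat).
Implicit Types (f g h F G : endo k n) (mu : 'I_n -> R) (th : R).

(** The two bounds are asymmetric because O(th^r) can fail: the iterates of (x1, x3 + x1 x2, x2)
    have degree r + 1 although th = 1. A bound for every t > th is all that the limit of r-th roots
    needs. *)
Definition growth f th : Prop :=
  [/\ 1 <= th,
      forall t, th < t -> exists C, forall r, (degree (endo_iter r f))%:R <= C * t ^+ r
    & exists2 c, 0 < c & forall r, c * th ^+ r <= (degree (endo_iter r f))%:R].

Lemma cvg_powR_inv (c : R) : 0 < c -> c `^ (r%:R)^-1 @[r --> \oo] --> (1 : R).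
Proof.
move=> c0; rewrite -[X in _ --> X](powRr0 c).
have inv0 : (r%:R : R)^-1 @[r --> \oo] --> (0 : R).
  by rewrite -cvg_shiftS; exact: cvg_harmonic.
rewrite /powR gt_eqF //.
apply: continuous_cvg; first exact: continuous_expR.
by apply: cvgM => //; apply: cvg_cst.
Qed.

Lemma growth_dynamical_degree f th : growth f th -> dynamical_degree R f = th.
Proof.
move=> [th1 up [c c0 lo]]; rewrite /dynamical_degree.
have th0 : 0 < th by exact: lt_le_trans th1.
have root (x t : R) r : 0 < x -> 0 < t -> (0 < r)%N ->
    (x * t ^+ r) `^ (r%:R)^-1 = x `^ (r%:R)^-1 * t.
  move=> x0 t0 r0; rewrite powRM ?(ltW x0) ?exprn_ge0 ?(ltW t0) //.
  congr (_ * _); rewrite -powR_mulrn ?(ltW t0) // -powRrM mulfV ?powRr1 ?(ltW t0) //.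
  by rewrite pnatr_eq0 -lt0n.
apply/cvg_lim => //; apply/cvgrPdist_le => e e0.
(* Half of the tolerance is spent on t = th + e/2, the other half on the r-th root of the constant,
   which tends to 1. *)
have [C0 C0P] : exists C, forall r, (degree (endo_iter r f))%:R <= C * (th + e / 2) ^+ r.
  by apply: up; rewrite ltrDl divr_gt0.
(* The constant must be positive for its r-th roots to tend to 1. *)
pose C := Num.max C0 1.
have C1 : 0 < C by rewrite lt_max ltr01 orbT.
have t0 : 0 < th + e / 2 by rewrite addr_gt0 // divr_gt0.
have CP r : (degree (endo_iter r f))%:R <= C * (th + e / 2) ^+ r.
  apply: le_trans (C0P r) _; rewrite ler_wpM2r ?exprn_ge0 ?(ltW t0) //.
  by rewrite le_max lexx.
have lim1 : C `^ (r%:R)^-1 * (th + e / 2) @[r --> \oo] --> th + e / 2.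
  rewrite -[X in _ --> X]mul1r; apply: cvgM; [exact: cvg_powR_inv|exact: cvg_cst].
have lim2 : c `^ (r%:R)^-1 * th @[r --> \oo] --> th.
  rewrite -[X in _ --> X]mul1r; apply: cvgM; [exact: cvg_powR_inv|exact: cvg_cst].
have e20 : 0 < e / 2 by rewrite divr_gt0.
move/cvgrPdist_le : lim1 => /(_ _ e20) lim1.
move/cvgrPdist_le : lim2 => /(_ _ e0) lim2.
near=> r.
(* At r = 0 the exponent is the conventional inverse of 0, which is 0, and [root] does not apply. *)
have r0 : (0 < r)%N by near: r; exists 1%N.
have h1 : `|th + e / 2 - C `^ (r%:R)^-1 * (th + e / 2)| <= e / 2 by near: r.
have h2 : `|th - c `^ (r%:R)^-1 * th| <= e by near: r.
have u1 : (degree (endo_iter r f))%:R `^ (r%:R)^-1 <= C `^ (r%:R)^-1 * (th + e / 2).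
  rewrite -root //; apply: ge0_ler_powR; rewrite ?nnegrE ?invr_ge0 ?ler0n //.
  by rewrite mulr_ge0 ?exprn_ge0 ?(ltW t0) ?(ltW C1).
have u2 : c `^ (r%:R)^-1 * th <= (degree (endo_iter r f))%:R `^ (r%:R)^-1.
  rewrite -root //; apply: ge0_ler_powR; rewrite ?nnegrE ?invr_ge0 ?ler0n //.
  by rewrite mulr_ge0 ?exprn_ge0 ?(ltW th0) ?(ltW c0).
move: h1 h2; rewrite !ler_norml => /andP[h1 h2] /andP[h3 h4].
by apply/andP; split; lra.
Unshelve. all: by end_near. Qed.

(** By submultiplicativity of the degree, the iterates of either map have degree at most deg h * deg
    h' times that of the other; for the lower bound the conjugation is undone. Both factors are
    positive because [h] and [h'] are automorphisms in positive dimension. *)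
Lemma growth_conj h h' f th : (0 < n)%N ->
  endo_comp h h' = endo_id k n -> endo_comp h' h = endo_id k n ->
  growth f th -> growth (endo_comp h (endo_comp f h')) th.
Proof.
move=> n0 hh' h'h [th1 up [c c0 lo]]; split=> //.
  move=> t /up[C CP]; exists ((degree h)%:R * C * (degree h')%:R) => r.
  rewrite endo_iter_conj // mulrAC.
  apply: (@le_trans _ _ ((degree h)%:R * (C * t ^+ r) * (degree h')%:R)); last first.
    by rewrite mulrA mulrAC.
  apply: (@le_trans _ _ ((degree h)%:R * (degree (endo_iter r f))%:R * (degree h')%:R)).
    rewrite -!natrM ler_nat -mulnA; apply: leq_trans (degree_comp _ _) _.
    by rewrite leq_mul2l degree_comp orbT.
  by rewrite ler_wpM2r // ler_wpM2l.
have dh : (0 < degree h)%N by apply: degree_automorphism => //; exists h'.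
have dh' : (0 < degree h')%N by apply: degree_automorphism => //; exists h.
exists (c / ((degree h)%:R * (degree h')%:R)).
  by rewrite divr_gt0 // mulr_gt0 // ltr0n.
move=> r; rewrite mulrAC ler_pdivrMr ?mulr_gt0 ?ltr0n //.
apply: le_trans (lo r) _; rewrite -!natrM ler_nat endo_iter_conj //.
set F := endo_comp h _.
have -> : endo_iter r f = endo_comp h' (endo_comp F h).
  by rewrite /F -!endo_compA h'h endo_compf1 endo_compA h'h endo_comp1f.
apply: leq_trans (degree_comp _ _) _.
by rewrite mulnA [X in (_ <= X)%N]mulnC leq_mul2l degree_comp orbT.
Qed.

Lemma lead_at_scale mu c D (p q : {mpoly k[n]}) : 0 < c -> lead_at mu D p q ->
  lead_at (fun i => c * mu i) (c * D) p q.
Proof.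
move=> c0 [hq pq]; split; first by apply: supp_inW hq => m <-; apply: wdegZ.
by apply: supp_inW pq => m; rewrite wdegZ ltr_pM2l.
Qed.

(** In f o f^r the variable x_j is replaced by a polynomial at level th^r mu_j, so [lead_at_comp]
    applies with mu rescaled by th^r on the source. *)
Lemma lead_at_iter mu th f g r i : 0 < th ->
  (forall i, lead_at mu (th * mu i) (tnth f i) (tnth g i)) ->
  lead_at mu (th ^+ r * mu i) (tnth (endo_iter r f) i) (tnth (endo_iter r g) i).
Proof.
move=> th0 fg; elim: r i => [|r IH] i.
  by rewrite mul1r /endo_iter /= tnth_endo_id; apply: lead_at_var.
rewrite (endo_iterS r f) (endo_iterS r g).
move: (endo_iter r f) (endo_iter r g) IH => F G IH; rewrite !tnth_endo_comp.
apply: lead_at_comp (IH) => /=.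
by rewrite exprS mulrAC mulrC; apply: lead_at_scale => //; rewrite exprn_gt0.
Qed.

(** Positivity of the weights makes the degree of a monomial at most a constant times its weight.
    The sums [M] and [d] stand in for the maxima of mu_i and of 1/mu_i. *)
Lemma degree_iter_le mu th f : 0 < th -> (forall i, 0 < mu i) ->
  (forall i, wle mu (th * mu i) (tnth f i)) ->
  exists C, forall r, (degree (endo_iter r f))%:R <= C * th ^+ r.
Proof.
move=> th0 mu0 fth.
pose M := \sum_i mu i + 1; pose d := \sum_i (mu i)^-1.
have muM i : mu i <= M.
  rewrite /M (bigD1 i) //= -addrA lerDl addr_ge0 ?ler01 // sumr_ge0 // => j _.
  exact: ltW.
have dmu i : (mu i)^-1 <= d.
  by rewrite /d (bigD1 i) //= lerDl sumr_ge0 // => j _; rewrite invr_ge0 ltW.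
have d0 : 0 <= d by rewrite sumr_ge0 // => j _; rewrite invr_ge0 ltW.
have M0 : 0 <= M by rewrite addr_ge0 // sumr_ge0 // => j _; rewrite ltW.
exists (d * M) => r; pose g := [tuple wpart mu (th * mu i) (tnth f i) | i < n].
have L i := @lead_at_iter mu th f g r i th0.
have {}L i : wle mu (th ^+ r * mu i) (tnth (endo_iter r f) i).
  apply: (@lead_at_wle _ _ _ _ _ _ (tnth (endo_iter r g) i)); apply: L => j.
  by rewrite tnth_mktuple; apply: lead_at_wpart.
have [->|dg] := eqVneq (degree (endo_iter r f)) 0%N.
  by rewrite !mulr_ge0 // exprn_ge0 // ltW.
have [N NE] : exists N, degree (endo_iter r f) = N.+1.
  by exists (degree (endo_iter r f)).-1; rewrite prednK // lt0n.
have [i [m [mi mN]]] : exists i m, m \in msupp (tnth (endo_iter r f) i) /\ (N < mdeg m)%N.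
  apply: contrapT => H; suff : (degree (endo_iter r f) <= N)%N by rewrite NE ltnn.
  apply: degree_le => i m mi; rewrite leqNgt; apply/negP => mN; apply: H.
  by exists i, m.
rewrite NE; apply: (@le_trans _ _ (mdeg m)%:R); first by rewrite ler_nat.
have := L i m mi => {}mi.
have : (mdeg m)%:R <= d * wdeg mu m.
  rewrite /wdeg mdegE natr_sum mulr_sumr ler_sum // => j _.
  rewrite mulrA ler_peMl // -ler_pdivrMr // mul1r; exact: dmu.
move/le_trans; apply; rewrite -mulrA ler_wpM2l //; apply: le_trans mi _.
by rewrite mulrC ler_wpM2r // exprn_ge0 // ltW.
Qed.

(** In this direction some weights may be 0, because a weight is at most [M] times the degree. Any
    monomial of the i-th component of g^r also occurs in f^r, and its weight is exactly th^r
    mu_i. *)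
Lemma degree_iter_ge mu th f g i : 0 < th -> (forall j, 0 <= mu j) -> 0 < mu i ->
  (forall i, lead_at mu (th * mu i) (tnth f i) (tnth g i)) ->
  (forall r, tnth (endo_iter r g) i != 0) ->
  exists2 c, 0 < c & forall r, c * th ^+ r <= (degree (endo_iter r f))%:R.
Proof.
move=> th0 mu0 mui fg g0; pose M := \sum_i mu i.
have M0 : 0 < M.
  rewrite /M (bigD1 i) //= ltr_pwDl // sumr_ge0 //.
exists (mu i / M) => [|r]; first by rewrite divr_gt0.
have L := lead_at_iter r i th0 fg; have := g0 r; rewrite -msupp_eq0.
case E : (msupp _) => [//|m s] _.
have mg : m \in msupp (tnth (endo_iter r g) i) by rewrite E mem_head.
have mE := L.1 _ mg; have mf : m \in msupp (tnth (endo_iter r f) i).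
  by move: mg; rewrite !mcoeff_msupp (lead_at_coeff m L); case: ifP => //; rewrite eqxx.
apply: (@le_trans _ _ (mdeg m)%:R); last by rewrite ler_nat (mdeg_le_degree mf).
rewrite mulrAC ler_pdivrMr // mulrC -mE /wdeg mulrC /M mulr_suml ler_sum // => j _.
by rewrite ler_wpM2l ?mu0 // ler_nat mdegE (bigD1 j) //= leq_addr.
Qed.

(** At th = 1 the lower bound is free: an automorphism in positive dimension is never constant. *)
Lemma growth1 f : (0 < n)%N -> is_automorphism f ->
  (forall t : R, 1 < t -> exists C, forall r, (degree (endo_iter r f))%:R <= C * t ^+ r) ->
  growth f 1.
Proof.
move=> n0 af up; split=> //; exists 1 => // r; rewrite expr1n mulr1 ler1n.
exact: degree_automorphism (is_automorphism_iter r af).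
Qed.

End Growth.

(** * Dependence on variables, algebraic independence, triangular automorphisms *)

Section Variables.
Variables (k : fieldType) (n : nat).
Implicit Types (f g h F G : endo k n) (p q : {mpoly k[n]}) (T : {set 'I_n}).

Definition supp_on T p := supp_in (fun m => forall j, j \notin T -> m j = 0%N) p.

Lemma supp_onW T T' p : T \subset T' -> supp_on T p -> supp_on T' p.
Proof.
move=> TT'; apply: supp_inW => m mT j jT'; apply: mT; apply: contraNN jT'.
exact: (fintype.subsetP TT').
Qed.

Lemma supp_onM T p q : supp_on T p -> supp_on T q -> supp_on T (p * q).
Proof. by apply: supp_inM => m1 m2 h1 h2 j jT; rewrite mnmDE h1 ?h2. Qed.

Lemma supp_onC T c : supp_on T (c%:MP_[n]).
Proof. by apply: supp_inC => j _; rewrite mnm0E. Qed.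

Lemma supp_onXn T p e : supp_on T p -> supp_on T (p ^+ e).
Proof.
move=> pT; elim: e => [|e IH]; first by rewrite expr0 -mpolyC1; apply: supp_onC.
by rewrite exprS; apply: supp_onM.
Qed.

Lemma supp_on_var T i : i \in T -> supp_on T ('X_i : {mpoly k[n]}).
Proof.
by move=> iT; apply: supp_inX => j jT; rewrite mnm1E; case: eqP => // ij; rewrite -ij iT in jT.
Qed.

Lemma supp_on_comp T T' p F : supp_on T p -> (forall j, j \in T -> supp_on T' (tnth F j)) ->
  supp_on T' (p \mPo F).
Proof.
move=> pT FT; rewrite comp_mpolyEX; apply: supp_in_sum => m mp _; apply: supp_inZ.
rewrite comp_mpolyX; elim/big_ind: _ => [|x y|j _].
- by rewrite -mpolyC1; apply: supp_onC.
- exact: supp_onM.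
have [jT|jT] := boolP (j \in T); first by apply: supp_onXn; apply: FT.
by rewrite (pT m mp j jT) expr0 -mpolyC1; apply: supp_onC.
Qed.

Lemma eq_comp_on T p F G : supp_on T p -> (forall j, j \in T -> tnth F j = tnth G j) ->
  p \mPo F = p \mPo G.
Proof.
move=> pT FG; rewrite [LHS]comp_mpolyEX [RHS]comp_mpolyEX; apply: eq_big_seq => m mp.
congr (_ *: _); rewrite !comp_mpolyX; apply: eq_bigr => j _.
have [jT|jT] := boolP (j \in T); first by rewrite FG.
by rewrite (pT m mp j jT) !expr0.
Qed.

Lemma supp_on0_const p : supp_on finset.set0 p -> p = (p@_0%MM)%:MP.
Proof.
move=> p0; apply/mpolyP => m; rewrite mcoeffC.
have [->|m0] := eqVneq m 0%MM; first by rewrite mulr1.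
rewrite mulr0; apply/eqP; rewrite mcoeff_eq0; apply/negP => /p0 h.
by case/eqP: m0; apply/mnmP => j; rewrite mnm0E h // inE.
Qed.

(* p viewed as a univariate polynomial in 'X_j, with leading coefficient q *)
Lemma lead_in_var j p : p != 0 -> exists M q,
  [/\ q != 0, forall m, m \in msupp q -> m j = 0%N,
      forall T, supp_on T p -> supp_on T q,
      forall m, m \in msupp (p - 'X_j ^+ M * q) -> (m j < M)%N
    & exists2 m, m \in msupp p & m j = M].
Proof.
move=> p0; have [m0 [hp [mp hp0 lp pM]]] := ex_lead_at (fun i => (i == j)%:R : rat) p0.
rewrite wdeg_indicator in lp pM.
(* [z] erases the exponent of 'X_j. All monomials of [hp] have the same exponent there, so [hp] is a
   power of 'X_j times [q]. *)
pose z (m : 'X_{1..n}) := [multinom if i == j then 0%N else m i | i < n].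
pose q := \sum_(m <- msupp hp) hp@_m *: 'X_[z m].
have hpE : hp = 'X_j ^+ (m0 j) * q.
  rewrite [LHS]mpolyE mulr_sumr; apply: eq_big_seq => m mh.
  have /eqP := lp.1 m mh; rewrite wdeg_indicator eqr_nat => /eqP mj.
  rewrite -scalerAr mpolyXn -mpolyXD; congr (_ *: 'X_[_]); apply/mnmP => i.
  rewrite mnmDE mulmnE mnm1E mnmE eq_sym; case: eqP => [->|_].
    by rewrite mul1n addn0.
  by rewrite mul0n add0n.
exists (m0 j), q; split=> [||T pT||].
- by apply: contraNneq hp0 => q0; rewrite hpE q0 mulr0.
- apply: supp_in_sum => m _ _; apply: supp_inZ; apply: supp_inX.
  by rewrite mnmE eqxx.
- apply: supp_in_sum => m mh _; apply: supp_inZ; apply: supp_inX => i iT.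
  rewrite mnmE; case: eqP => // _; apply: pT iT.
  by move: mh; rewrite !mcoeff_msupp (lead_at_coeff m lp); case: ifP => //; rewrite eqxx.
- by rewrite -hpE => m /lp.2; rewrite wdeg_indicator ltr_nat.
- by exists m0.
Qed.

(** The factor [N] prepares a substitution in which 'X_j becomes a polynomial of degree [N] in some
    chosen variable, while the other variables become polynomials free of it. *)
Lemma lead_at_in_var (N : nat) j M p q : (0 < N)%N -> (forall m, m \in msupp q -> m j = 0%N) ->
  (forall m, m \in msupp (p - 'X_j ^+ M * q) -> (m j < M)%N) ->
  lead_at (fun i => N%:R * (i == j)%:R : rat) (N%:R * M%:R) p ('X_j ^+ M * q).
Proof.
move=> N0 qj pq; split=> m; last first.
  by move/pq => h; rewrite wdegZ wdeg_indicator ltr_pM2l ?ltr0n // ltr_nat.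
move=> mq; rewrite wdegZ wdeg_indicator; congr (_ * _%:R); move: m mq.
apply: supp_inM (_ : supp_in (fun m => m j = M) _) qj => [m1 m2 h1 h2|].
  by rewrite mnmDE h1 h2 addn0.
by rewrite mpolyXn; apply: supp_inX; rewrite mulmnE mnm1E eqxx mul1n.
Qed.

(** This is algebraic independence of the components of [g] with index in [T], the form of dominance
    that works in every characteristic. *)
Definition inj_on T g := forall p, supp_on T p -> p != 0 -> p \mPo g != 0.

Lemma inj_on0 g : inj_on finset.set0 g.
Proof. by move=> p /supp_on0_const ->; rewrite comp_mpolyC !mpolyC_eq0. Qed.

(** Among the components indexed by [T], only g_j0 involves 'X_i0. Writing p = X_j0^M q + lower
    terms, the top part of p(g) in 'X_i0 is the M-th power of the top part of g_j0 times q(g), and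
    q(g) is nonzero by independence of the remaining components. *)
Lemma inj_on_step T j0 i0 g : j0 \in T ->
  (forall j, j \in T -> j != j0 -> forall m, m \in msupp (tnth g j) -> m i0 = 0%N) ->
  (exists2 m, m \in msupp (tnth g j0) & m i0 != 0%N) ->
  inj_on (T :\ j0) g -> inj_on T g.
Proof.
move=> j0T gT [m1 m1g m1i] IH p pT p0.
have g0 : tnth g j0 != 0 by apply: contraTneq m1g => ->; rewrite msupp0.
have [N [hq [mN hq0 lg gN]]] := ex_lead_at (fun i => (i == i0)%:R : rat) g0.
have N0 : (0 < N i0)%N.
  have := gN m1 m1g; rewrite /= !wdeg_indicator ler_nat; apply: leq_trans.
  by rewrite lt0n.
have [M [q [q0 qj qT pq _]]] := lead_in_var j0 p0.
(* [lead_at_comp] needs a level for every component; those outside [T], invisible to p, are set to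
   0. *)
pose Y := [tuple if j \in T then tnth g j else 0 | j < n].
pose H := [tuple if j \in T then if j == j0 then hq else tnth g j else 0 | j < n].
rewrite (@eq_comp_on T p g Y) //; last by move=> j jT; rewrite tnth_mktuple jT.
have L : lead_at (fun i => (i == i0)%:R : rat) ((N i0)%:R * M%:R) (p \mPo Y)
    (('X_j0 ^+ M * q) \mPo H).
  apply: lead_at_comp (lead_at_in_var N0 qj pq) _ => j; rewrite !tnth_mktuple.
  case: ifP => jT; last exact: lead_at0.
  case: eqP => [->|/eqP jj0]; first by rewrite mulr1 -wdeg_indicator.
  rewrite mulr0; apply: lead_at_homog => m mg.
  by rewrite wdeg_indicator (gT j jT jj0 m mg).
apply: lead_at_neq0 L _; rewrite rmorphM rmorphXn /= comp_mpoly_var.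
rewrite mulf_neq0 // ?expf_neq0 // ?tnth_mktuple ?j0T ?eqxx //.
have qT' : supp_on (T :\ j0) q.
  move=> m mq j; rewrite finset.in_setD1 negb_and negbK => /orP[/eqP -> |jT]; first exact: qj.
  exact: (qT T pT m mq j jT).
rewrite (@eq_comp_on _ q H g qT'); first exact: IH.
by move=> j; rewrite finset.in_setD1 tnth_mktuple => /andP[/negbTE -> ->].
Qed.

Lemma inj_on_iter T g r : (forall j, j \in T -> supp_on T (tnth g j)) -> inj_on T g ->
  inj_on T (endo_iter r g).
Proof.
move=> gT gI; elim: r => [|r IH] p pT p0; first by rewrite comp_mpoly_id.
rewrite endo_iterS -comp_mpolyA; apply: IH; last exact: gI.
exact: supp_on_comp gT.
Qed.

Lemma endo_iter_neq0 T g r i : (forall j, j \in T -> supp_on T (tnth g j)) -> inj_on T g ->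
  i \in T -> tnth (endo_iter r g) i != 0.
Proof.
move=> gT gI iT; rewrite -(comp_mpoly_var i (endo_iter r g)).
by apply: (inj_on_iter r gT gI); [apply: supp_on_var|rewrite -msupp_eq0 msuppX].
Qed.

Lemma inj_automorphism f p : is_automorphism f -> p != 0 -> p \mPo f != 0.
Proof.
move=> [g [fg _]]; apply: contraNneq => pf.
by rewrite -(comp_mpoly_id p) -/(endo_id k n) -fg -comp_mpolyA pf raddf0.
Qed.

(** Compare degrees in 'X_i in the identity tau_i(g) = X_i, where g is the inverse. If g_1, ...,
    g_(i-1) are free of 'X_i, the degrees of tau_i and of g_i in 'X_i have product 1. Then X_i = h *
    q(g) with h nonconstant, so q(g), and hence the coefficient q of 'X_i in tau_i, is a nonzero
    constant. *)
Lemma triangular_automorphism_shape tau (i : 'I_n) : is_triangular tau -> is_automorphism tau ->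
  exists a r, [/\ a != 0, supp_on [set j : 'I_n | (j < i)%N]%SET r & tnth tau i = a *: 'X_i + r].
Proof.
move=> ttau [g [tg gt]].
have ag : is_automorphism g by exists tau.
(* Triangularity of the inverse is carried along in the induction: it is what keeps the earlier
   components of g free of 'X_i. *)
suff [] : (exists a r, [/\ a != 0, supp_on [set j : 'I_n | (j < i)%N]%SET r
    & tnth tau i = a *: 'X_i + r]) /\ supp_on [set j : 'I_n | (j <= i)%N]%SET (tnth g i) by [].
have [N] := ubnP i; elim: N i => // N IHN i; rewrite ltnS => iN.
have IH (j : 'I_n) : (j < i)%N -> supp_on [set l : 'I_n | (l < i)%N]%SET (tnth g j).
  move=> ji; have [_] := IHN j (leq_trans ji iN).
  by apply: supp_onW; apply/fintype.subsetP => l; rewrite !inE => /leq_ltn_trans; apply.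
have IH0 (j : 'I_n) : (j < i)%N -> forall m, m \in msupp (tnth g j) -> m i = 0%N.
  by move=> ji m mg; apply: (IH j ji m mg); rewrite inE ltnn.
pose T := [set j : 'I_n | (j <= i)%N]%SET.
have tT : supp_on T (tnth tau i).
  by move=> m mt j; rewrite inE -ltnNge; apply: ttau.
have ti : tnth tau i \mPo g = 'X_i by rewrite -tnth_endo_comp tg tnth_endo_id.
have X0 j : 'X_j != 0 :> {mpoly k[n]} by rewrite -msupp_eq0 msuppX.
have t0 : tnth tau i != 0 by apply: contraNneq (X0 i) => E; rewrite -ti E raddf0.
have g0 : tnth g i != 0 by rewrite -comp_mpoly_var; apply: inj_automorphism.
pose mu := (fun j => (j == i)%:R : rat).
have [E [h [mE h0 lg gE]]] := ex_lead_at mu g0; rewrite wdeg_indicator in lg gE.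
pose Y := [tuple if j \in T then tnth g j else 0 | j < n].
have tY : tnth tau i \mPo Y = 'X_i.
  by rewrite -ti; apply: eq_comp_on tT _ => j jT; rewrite tnth_mktuple jT.
have Xlead : lead_at mu 1 ('X_i : {mpoly k[n]}) 'X_i.
  by have := lead_at_var k mu i; rewrite /mu eqxx.
have Yj (j : 'I_n) : j != i -> lead_at mu 0 (tnth Y j) (tnth Y j).
  move=> ji; rewrite tnth_mktuple inE leq_eqVlt.
  have -> : (nat_of_ord j == i) = false by apply/negbTE.
  case: ifP => /= jlt; last exact: lead_at0.
  by apply: lead_at_homog => m /(IH0 j jlt) mi; rewrite wdeg_indicator mi.
(* If g_i did not involve 'X_i either, nor would tau_i(g), which is 'X_i. *)
have E0 : (0 < E i)%N.
  rewrite lt0n; apply/negP => /eqP E0; rewrite E0 in gE.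
  have /(_ U_(i)%MM) : wle mu 0 ('X_i : {mpoly k[n]}).
    rewrite -tY; apply: (@wle_comp _ _ _ _ (fun=> 0)) => [m _|j].
      by rewrite /wdeg big1 // => j _; rewrite mul0r.
    have [->|ji] := eqVneq j i; first by rewrite tnth_mktuple inE leqnn.
    exact: lead_at_wle (Yj j ji).
  by rewrite msuppX mem_head wdeg1 /mu eqxx ler10 => /(_ isT).
have [M [q [q0 qj qT pq _]]] := lead_in_var i t0.
pose H := [tuple if j == i then h else tnth Y j | j < n].
have L : lead_at mu ((E i)%:R * M%:R) (tnth tau i \mPo Y) (('X_i ^+ M * q) \mPo H).
  apply: lead_at_comp (lead_at_in_var E0 qj pq) _ => j; rewrite [tnth H j]tnth_mktuple.
  have [->|ji] := eqVneq j i; first by rewrite mulr1 tnth_mktuple inE leqnn.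
  by rewrite mulr0; apply: Yj.
have qH : q \mPo H = q \mPo g.
  apply: (@eq_comp_on (T :\ i)) => [m mq j|j].
    rewrite finset.in_setD1 negb_and negbK => /orP[/eqP ->|jT]; first exact: qj.
    exact: (qT T tT m mq j jT).
  by rewrite finset.in_setD1 !tnth_mktuple => /andP[/negbTE -> ->].
rewrite tY rmorphM rmorphXn /= comp_mpoly_var qH tnth_mktuple eqxx in L.
have qg0 : q \mPo g != 0 by apply: inj_automorphism.
have EM : (E i * M)%N = 1%N.
  apply/eqP; rewrite -(eqr_nat rat) natrM; apply/eqP.
  by apply: (lead_at_inj L Xlead) => //; rewrite mulf_neq0 ?expf_neq0.
move/eqP: EM; rewrite muln_eq1 => /andP[/eqP E1 /eqP M1].
rewrite E1 M1 mul1r expr1 in L.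
have XE : 'X_i = h * (q \mPo g) by rewrite [LHS](lead_at_wpartE Xlead) (lead_at_wpartE L).
(* [msize] is the degree plus one, and [msize] of 'X_i is 2: as [h] has degree at least 1, the other
   factor has degree 0. *)
have h2 : (1 < msize h)%N.
  have : msupp h != [::] by rewrite msupp_eq0.
  case Eh : (msupp h) => [//|m s] _; have mh : m \in msupp h by rewrite Eh mem_head.
  have := lg.1 m mh; rewrite E1 wdeg_indicator => /eqP; rewrite eqr_nat => /eqP m1.
  by apply: leq_trans (msize_mdeg_lt mh); rewrite ltnS mdegE (bigD1 i) //= m1.
have qg1 : msize (q \mPo g) == 1%N.
  have := congr1 (fun p => msize p) XE; rewrite msizeX mdeg1 msizeM //.
  have : (0 < msize (q \mPo g))%N by rewrite lt0n msize_poly_eq0.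
  by move: (msize h) (msize (q \mPo g)) h2 => a b; lia.
case/msize_poly1P: qg1 => c c0 qgc.
have qc : q = c%:MP.
  by rewrite -[LHS]comp_mpoly_id -/(endo_id k n) -gt -comp_mpolyA qgc comp_mpolyC.
have rT : supp_on [set j : 'I_n | (j < i)%N]%SET (tnth tau i - c *: 'X_i).
  move: pq; rewrite M1 expr1 qc mulrC mul_mpolyC => pq m mt j.
  rewrite inE -leqNgt leq_eqVlt => /orP[/eqP ij|ij].
    by have := pq m mt; rewrite ltnS leqn0 => /eqP; rewrite (val_inj ij).
  have h' : supp_on T (tnth tau i - c *: 'X_i).
    by apply: supp_inB tT (supp_inZ _); apply: supp_on_var; rewrite inE leqnn.
  by apply: h' mt _ _; rewrite inE -ltnNge.
split; first by exists c, (tnth tau i - c *: 'X_i); split=> //; rewrite addrC subrK.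
have -> : tnth g i = c^-1 *: ('X_i - ((tnth tau i - c *: 'X_i) \mPo g)).
  rewrite comp_mpolyB ti comp_mpolyZ comp_mpoly_var opprB addrCA subrr addr0.
  by rewrite scalerA mulVf // scale1r.
apply: supp_inZ; apply: supp_inB; first by apply: supp_on_var; rewrite inE leqnn.
apply: (@supp_onW [set j : 'I_n | (j < i)%N]%SET).
  by apply/fintype.subsetP => j; rewrite !inE => /ltnW.
by apply: supp_on_comp rT _ => j; rewrite inE; apply: IH.
Qed.

End Variables.

(** * Bruhat decomposition by elimination *)

Section Bruhat.
Variable k : fieldType.

Definition lower_mx n (A : 'M[k]_n) := forall i j : 'I_n, (i < j)%N -> A i j = 0.

Lemma lower_mx1 n : lower_mx (1%:M : 'M[k]_n).
Proof. by move=> i j ij; rewrite mxE; case: eqP => // E; rewrite E ltnn in ij. Qed.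

Lemma lower_mxM n (A B : 'M[k]_n) : lower_mx A -> lower_mx B -> lower_mx (A *m B).
Proof.
move=> lA lB i j ij; rewrite mxE big1 // => l _.
have [li|il] := leqP l i; first by rewrite lB ?mulr0 // (leq_ltn_trans li).
by rewrite lA ?mul0r.
Qed.

(** A new row [i0] and a new column [j0] meet in a 1 and vanish elsewhere. The two indices are
    independent so that a pivot off the diagonal can be inserted and absorbed into the
    permutation. *)
Definition extend_mx n (i0 j0 : 'I_n.+1) (A : 'M[k]_n) : 'M[k]_n.+1 :=
  \matrix_(i, j) if unlift i0 i is Some i' then
                   if unlift j0 j is Some j' then A i' j' else 0
                 else (j == j0)%:R.

Lemma extend_mxM n (i0 j0 l0 : 'I_n.+1) (A B : 'M[k]_n) :
  extend_mx i0 j0 A *m extend_mx j0 l0 B = extend_mx i0 l0 (A *m B).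
Proof.
apply/matrixP => i l; rewrite !mxE (bigD1_ord j0) //= !mxE unlift_none.
case: (unliftP i0 i) => [i' ->|->].
  rewrite mul0r add0r; under eq_bigr => j _ do rewrite !mxE !liftK.
  case: (unliftP l0 l) => [l' _|_]; first by rewrite mxE.
  by rewrite big1 // => j _; rewrite mulr0.
rewrite eqxx mul1r big1 ?addr0 // => j _.
by rewrite !mxE unlift_none eq_sym (negbTE (neq_lift _ _)) mul0r.
Qed.

Lemma extend_perm_mx n (i0 j0 : 'I_n.+1) (s : {perm 'I_n}) :
  extend_mx i0 j0 (perm_mx s) = perm_mx (lift_perm i0 j0 s).
Proof.
apply/matrixP => i j; rewrite [RHS]mxE [RHS]mxE mxE; case: (unliftP i0 i) => [i' ->|->].
  rewrite lift_perm_lift; case: (unliftP j0 j) => [j' ->|->].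
    by rewrite !mxE (inj_eq lift_inj).
  by rewrite eq_sym (negbTE (neq_lift _ _)).
by rewrite lift_perm_id eq_sym.
Qed.

Lemma lower_extend_mx n (i0 : 'I_n.+1) (A : 'M[k]_n) :
  lower_mx A -> lower_mx (extend_mx i0 i0 A).
Proof.
move=> lA i j; rewrite mxE; case: unliftP => [i' ->|->]; last first.
  by move=> ij; case: eqP => // E; rewrite E ltnn in ij.
case: unliftP => [j' ->|//]; rewrite ltnNge leq_bump2 -ltnNge; exact: lA.
Qed.

(** Take as pivot the last nonzero entry of the first row. Clearing its column is a lower triangular
    row operation; clearing its row only concerns columns to the left of the pivot, so that
    operation is lower triangular too. Induction handles the complementary minor. *)
Lemma bruhat_decomposition n (A : 'M[k]_n) : A \in unitmx ->
  exists (L1 L2 : 'M[k]_n) (s : {perm 'I_n}), [/\ lower_mx L1, lower_mx L2 & A = L1 *m perm_mx s *m L2].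
Proof.
elim: n A => [A _|n IH A uA].
  by exists 1%:M, 1%:M, 1%g; split; try exact: lower_mx1; apply/matrixP => -[].
have [j0 Aj0] : exists j, A ord0 j != 0.
  apply: contrapT => H; move: uA; rewrite unitmxE (expand_det_row A ord0) big1 ?unitr0 //.
  move=> j _; have [->|Aj] := eqVneq (A ord0 j) 0; first by rewrite mul0r.
  by case: H; exists j.
have [j Aj jmax] : exists2 j, A ord0 j != 0 & forall l : 'I_n.+1, (j < l)%N -> A ord0 l = 0.
  case: (@arg_maxnP _ j0 (fun j => A ord0 j != 0) (fun j => nat_of_ord j) Aj0) => j Aj jmax.
  exists j => // l jl; apply/eqP; apply: contraLR jl => Al; rewrite -leqNgt; exact: jmax.
pose a := A ord0 j.
(* The Schur complement of the pivot [a]. Below, [L1] carries the pivot column divided by [a], and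
   [L2] carries the pivot row as its row [j], which is lower triangular by the choice of [j]. *)
pose A' := \matrix_(i < n, l < n) (A (lift ord0 i) (lift j l)
   - A (lift ord0 i) j * A ord0 (lift j l) / a).
pose L1 := \matrix_(i < n.+1, l < n.+1) if l == ord0 then A i j / a else (i == l)%:R.
pose L2 := \matrix_(i < n.+1, l < n.+1) if i == j then A ord0 l else (i == l)%:R.
have lL1 : lower_mx L1.
  move=> i l il; rewrite mxE; case: eqP => [E|_]; first by rewrite E in il.
  by case: eqP => // E; rewrite E ltnn in il.
have lL2 : lower_mx L2.
  move=> i l il; rewrite mxE; case: eqP => [E|_]; first by rewrite jmax // -E.
  by case: eqP => // E; rewrite E ltnn in il.
have AE : A = L1 *m extend_mx ord0 j A' *m L2.
  have BL2 i l : (extend_mx ord0 j A' *m L2) i l =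
      if unlift ord0 i is Some i' then
        if unlift j l is Some l' then A' i' l' else 0 else A ord0 l.
    rewrite mxE (bigD1_ord j) //= !mxE eqxx unlift_none.
    case: unliftP => [i' ->|->].
      rewrite mul0r add0r; case: (unliftP j l) => [l' ->|->].
        rewrite (bigD1 l') //= !mxE !liftK (eq_sym (lift _ _)) (negbTE (neq_lift _ _)).
        rewrite eqxx mulr1 mxE big1 ?addr0 // => m ml.
        rewrite !mxE !liftK (eq_sym (lift _ _) j) (negbTE (neq_lift _ _)).
        by rewrite (inj_eq lift_inj) (negbTE ml) mulr0.
      rewrite big1 // => m _; rewrite [L2 _ _]mxE (eq_sym (lift _ _) j) (negbTE (neq_lift _ _)).
      by rewrite mulr0.
    rewrite mul1r big1 ?addr0 // => m _; rewrite !mxE unlift_none.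
    by rewrite (eq_sym (lift _ _) j) (negbTE (neq_lift _ _)) mul0r.
  apply/matrixP => i l; rewrite -mulmxA mxE (bigD1_ord ord0) //= BL2 unlift_none mxE eqxx.
  case: (unliftP ord0 i) => [i' ->|->]; last first.
    rewrite divff // mul1r big1 ?addr0 // => m _; rewrite mxE.
    by rewrite (eq_sym (lift _ _)) (negbTE (neq_lift _ _)) mul0r.
  rewrite (bigD1 i') //= big1 => [|m mi].
    rewrite mxE BL2 liftK (eq_sym (lift _ _)) (negbTE (neq_lift _ _)) eqxx mul1r addr0.
    case: (unliftP j l) => [l' ->|->]; last by rewrite divfK // addr0.
    by rewrite mxE mulrAC addrC subrK.
  rewrite mxE (eq_sym (lift ord0 m) ord0) (negbTE (neq_lift _ _)).
  by rewrite (inj_eq lift_inj) eq_sym (negbTE mi) mul0r.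
have uA' : A' \in unitmx.
  have : extend_mx ord0 j A' \in unitmx.
    by move: uA; rewrite AE !unitmx_mul => /andP[/andP[_ ->]].
  rewrite unitmxE (expand_det_row _ ord0) (bigD1 j) //= big1 => [|l lj].
    rewrite mxE unlift_none eqxx mul1r addr0 /cofactor.
    have -> : row' ord0 (col' j (extend_mx ord0 j A')) = A'.
      by apply/matrixP => p q; rewrite !mxE !liftK mxE.
    by rewrite unitrM => /andP[_]; rewrite unitmxE.
  by rewrite mxE unlift_none (negbTE lj) mul0r.
have [L1' [L2' [s [l1 l2 sE]]]] := IH A' uA'.
exists (L1 *m extend_mx ord0 ord0 L1'), (extend_mx j j L2' *m L2), (lift_perm ord0 j s).
split.
- by apply: lower_mxM => //; apply: lower_extend_mx.
- by apply: lower_mxM => //; apply: lower_extend_mx.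
rewrite {1}AE sE -(extend_mxM ord0 j j) -(extend_mxM ord0 ord0 j) extend_perm_mx.
by rewrite !mulmxA.
Qed.

End Bruhat.

(** * Affine automorphisms and the normal form *)

Section Affine.
Variables (k : fieldType) (n : nat).
Implicit Types (M N : 'M[k]_n) (v w : 'cV[k]_n).

Definition affine_endo M v : endo k n :=
  [tuple \sum_j M i j *: 'X_j + (v i ord0)%:MP | i < n].

Lemma affine_endo_comp M N v w :
  endo_comp (affine_endo M v) (affine_endo N w) = affine_endo (M *m N) (M *m w + v).
Proof.
apply: eq_from_tnth => i; rewrite tnth_endo_comp [tnth _ i]tnth_mktuple [RHS]tnth_mktuple.
rewrite comp_mpolyD comp_mpolyC raddf_sum /=.
under eq_bigr => j _ do rewrite comp_mpolyZ comp_mpoly_var tnth_mktuple scalerDr.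
rewrite big_split /= mxE [in RHS]mpolyCD addrA; congr (_ + _); congr (_ + _).
  under eq_bigr => j _ do rewrite scaler_sumr.
  rewrite exchange_big /=; apply: eq_bigr => j _; rewrite mxE scaler_suml.
  by apply: eq_bigr => l _; rewrite scalerA.
rewrite mxE raddf_sum /=; apply: eq_bigr => j _.
by rewrite -mul_mpolyC -mpolyCM.
Qed.

Lemma affine_endo1 : affine_endo 1%:M 0 = endo_id k n.
Proof.
apply: eq_from_tnth => i; rewrite tnth_endo_id tnth_mktuple mxE mpolyC0 addr0.
rewrite (bigD1 i) //= mxE eqxx scale1r big1 ?addr0 // => j ji.
by rewrite mxE eq_sym (negbTE ji) scale0r.
Qed.

Lemma affine_endoV M v : M \in unitmx -> exists N w,
  endo_comp (affine_endo M v) (affine_endo N w) = endo_id k n /\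
  endo_comp (affine_endo N w) (affine_endo M v) = endo_id k n.
Proof.
move=> uM; exists (invmx M), (- (invmx M *m v)).
rewrite !affine_endo_comp mulmxV // mulVmx // mulmxN mulmxA mulmxV // mul1mx addNr subrr.
by rewrite affine_endo1.
Qed.

Lemma degree_affine_endo M v : (degree (affine_endo M v) <= 1)%N.
Proof.
apply: degree_le => i; rewrite tnth_mktuple; apply: supp_inD.
  by apply: supp_in_sum => j _ _; apply: supp_inZ; apply: supp_inX; rewrite mdeg1.
by apply: supp_inC; rewrite mdeg0.
Qed.

Lemma affine_automorphism_mx (f : endo k n) : is_affine_automorphism f ->
  exists M v, M \in unitmx /\ f = affine_endo M v.
Proof.
move=> [[g [fg _]] f1].
pose M := \matrix_(i, j) (tnth f i)@_(U_(j)%MM).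
pose v := \col_i (tnth f i)@_0%MM.
have fE : f = affine_endo M v.
  apply: eq_from_tnth => i; rewrite tnth_mktuple; apply/mpolyP => m.
  rewrite mcoeffD mcoeffC mxE raddf_sum /=.
  under eq_bigr => j _ do rewrite mcoeffZ mxE mcoeffX.
  have [->|m0] := eqVneq m 0%MM.
    by rewrite big1 ?add0r ?mulr1 // => j _; rewrite mnm1_eq0 mulr0.
  rewrite mulr0 addr0; have [/eqP/mdeg1P[j /eqP ->]|m1] := eqVneq (mdeg m) 1%N.
    rewrite (bigD1 j) //= eqxx mulr1 big1 ?addr0 // => l lj.
    by rewrite eq_mnm1 (negbTE lj) mulr0.
  rewrite big1 => [|j _]; last first.
    by case: eqP => [E|_]; [rewrite -E mdeg1 in m1|rewrite mulr0].
  apply/eqP; rewrite mcoeff_eq0; apply/negP => /mdeg_le_degree; rewrite f1.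
  by rewrite leq_eqVlt (negbTE m1) ltnS leqn0 mdeg_eq0 (negbTE m0).
exists M, v; split=> //; rewrite -row_free_unit -kermx_eq0; apply/eqP/row_matrixP => i.
rewrite row0; set c := row i _; have cM : c *m M = 0.
  by rewrite -row_mul mulmx_ker row0.
apply/rowP => j; rewrite [RHS]mxE.
(* A vector [c] in the left kernel of [M] makes the combination of the f_i with coefficients [c]
   constant. Substituting the inverse [g] turns this combination into a linear form, which must then
   be 0. *)
have E : \sum_i c ord0 i *: 'X_i = (\sum_i c ord0 i * v i ord0)%:MP_[n].
  transitivity ((\sum_i c ord0 i *: tnth f i) \mPo g).
    rewrite raddf_sum /=; apply: eq_bigr => l _.
    by rewrite comp_mpolyZ -tnth_endo_comp fg tnth_endo_id.
  rewrite -[RHS](comp_mpolyC _ g); congr (_ \mPo g); rewrite fE.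
  under eq_bigr => l _ do rewrite tnth_mktuple scalerDr scaler_sumr.
  rewrite big_split /= exchange_big big1 ?add0r /= => [|l _].
    rewrite raddf_sum /=; apply: eq_bigr => l _; rewrite -mul_mpolyC -mpolyCM.
    by [].
  have := congr1 (fun A : 'rV[k]_n => A ord0 l) cM; rewrite !mxE => cl.
  under eq_bigr => m _ do rewrite scalerA.
  by rewrite -scaler_suml cl scale0r.
have := congr1 (mcoeff U_(j)%MM) E; rewrite mcoeffC mnm1_eq0 mulr0 raddf_sum /=.
rewrite (bigD1 j) //= mcoeffZ mcoeffX eqxx mulr1 big1 ?addr0 // => l lj.
by rewrite mcoeffZ mcoeffX eq_mnm1 (negbTE lj) mulr0.
Qed.

Lemma lower_affine_triangular M v : lower_mx M -> is_triangular (affine_endo M v).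
Proof.
move=> lM i m mi j ij; move: m mi; rewrite tnth_mktuple; apply: supp_inD; last first.
  by apply: supp_inC; rewrite mnm0E.
apply: supp_in_sum => l _ _; have [li|il] := leqP l i; last first.
  by rewrite (lM _ _ il) scale0r; apply: supp_in0.
apply: supp_inZ; apply: supp_inX; rewrite mnm1E; case: eqP => // E.
by rewrite E leqNgt ij in li.
Qed.

Lemma is_triangularP (f : endo k n) :
  is_triangular f <-> forall i : 'I_n, supp_on [set j : 'I_n | (j <= i)%N]%SET (tnth f i).
Proof.
split=> [tf i m mi j|tf i m mi j ij]; first by rewrite inE -ltnNge; apply: tf.
by apply: tf mi _ _; rewrite inE -ltnNge.
Qed.

Lemma triangular_comp (f g : endo k n) :
  is_triangular f -> is_triangular g -> is_triangular (endo_comp f g).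
Proof.
move=> /is_triangularP tf /is_triangularP tg; apply/is_triangularP => i.
rewrite tnth_endo_comp; apply: supp_on_comp (tf i) _ => j; rewrite inE => ji.
apply: supp_onW (tg j); apply/fintype.subsetP => l; rewrite !inE => lj.
exact: leq_trans lj ji.
Qed.

Lemma perm_affine_endo_comp (s : {perm 'I_n}) (f : endo k n) :
  endo_comp (affine_endo (perm_mx s) 0) f = [tuple tnth f (s i) | i < n].
Proof.
apply: eq_from_tnth => i; rewrite tnth_endo_comp !tnth_mktuple mxE mpolyC0 addr0.
rewrite (bigD1 (s i)) //= big1 => [|j ji]; last first.
  by rewrite !mxE eq_sym (negbTE ji) scale0r.
by rewrite addr0 !mxE eqxx scale1r comp_mpoly_var.
Qed.

(** If alpha has linear part L1 s L2, conjugating alpha o tau by the affine map with linear part L1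
    moves L1 to the right end and leaves s o (L2 tau L1). The translation is absorbed into the
    conjugating map. The degree does not grow, because tau is alpha^-1 o f and all other factors are
    affine. *)
Lemma affine_triangular_normal_form (f : endo k n) :
  is_automorphism f -> is_affine_triangular f ->
  exists h h' (s : {perm 'I_n}) tau,
   [/\ endo_comp h h' = endo_id k n, endo_comp h' h = endo_id k n,
       is_triangular tau, is_automorphism tau &
       (degree tau <= degree f)%N /\
       endo_comp h' (endo_comp f h) = [tuple tnth tau (s i) | i < n]].
Proof.
move=> af [alpha [tau [aalpha ttau fE]]].
have [M [v [uM aE]]] := affine_automorphism_mx aalpha.
have [L1 [L2 [s [l1 l2 ME]]]] := bruhat_decomposition uM.
have [uL1 uL2] : L1 \in unitmx /\ L2 \in unitmx.
  by move: uM; rewrite ME !unitmx_mul => /andP[/andP[-> _] ->].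
have [N [w [hh' h'h]]] := affine_endoV v uL1.
have [N2 [w2 [b1 b2]]] := affine_endoV 0 uL2.
have [N3 [w3 [c1 c2]]] := affine_endoV v uM.
have tauE : tau = endo_comp (affine_endo N3 w3) f.
  by rewrite fE aE endo_compA c2 endo_comp1f.
exists (affine_endo L1 v), (affine_endo N w), s,
  (endo_comp (affine_endo L2 0) (endo_comp tau (affine_endo L1 v))); split.
- exact: hh'.
- exact: h'h.
- apply: triangular_comp; first exact: lower_affine_triangular.
  by apply: triangular_comp ttau _; apply: lower_affine_triangular.
- apply: is_automorphism_comp; first by exists (affine_endo N2 w2).
  apply: is_automorphism_comp; last by exists (affine_endo N w).
  rewrite tauE; apply: is_automorphism_comp af.
  by exists (affine_endo M v).
split.
  apply: leq_trans (degree_comp _ _) _.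
  apply: leq_trans (leq_mul (degree_affine_endo _ _) (degree_comp _ _)) _.
  rewrite mul1n; apply: leq_trans (leq_mul (leqnn _) (degree_affine_endo _ _)) _.
  rewrite muln1 tauE; apply: leq_trans (degree_comp _ _) _.
  by apply: leq_trans (leq_mul (degree_affine_endo _ _) (leqnn _)) _; rewrite mul1n.
have -> : f = endo_comp (affine_endo L1 v) (endo_comp (affine_endo (perm_mx s) 0)
    (endo_comp (affine_endo L2 0) tau)).
  rewrite fE aE !endo_compA !affine_endo_comp !mulmx0 !add0r -ME.
  reflexivity.
set G := endo_comp (affine_endo (perm_mx s) 0) _.
rewrite -(endo_compA _ G) (endo_compA (affine_endo N w)) h'h endo_comp1f /G.
rewrite -(endo_compA (affine_endo (perm_mx s) 0)) -(endo_compA (affine_endo L2 0)).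
exact: perm_affine_endo_comp.
Qed.

End Affine.

(** * Indices and weights in three variables *)

Local Notation i0 := (inord 0 : 'I_3).
Local Notation i1 := (inord 1 : 'I_3).
Local Notation i2 := (inord 2 : 'I_3).

Lemma ord3_ind (P : 'I_3 -> Prop) : P i0 -> P i1 -> P i2 -> forall i, P i.
Proof.
move=> P0 P1 P2 i.
have -> : i = inord (nat_of_ord i) by rewrite inord_val.
by case: i => [[|[|[|]]]].
Qed.

Lemma tnth3_0 T (a b c : T) : tnth [tuple a; b; c] i0 = a.
Proof. by rewrite (tnth_nth a) /= inordK. Qed.

Lemma tnth3_1 T (a b c : T) : tnth [tuple a; b; c] i1 = b.
Proof. by rewrite (tnth_nth a) /= inordK. Qed.

Lemma tnth3_2 T (a b c : T) : tnth [tuple a; b; c] i2 = c.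
Proof. by rewrite (tnth_nth a) /= inordK. Qed.

Definition tnth3 := (tnth3_0, tnth3_1, tnth3_2).

Lemma ord3_eq : ((i0 == i1) = false) * ((i0 == i2) = false) * ((i1 == i0) = false) *
  ((i1 == i2) = false) * ((i2 == i0) = false) * ((i2 == i1) = false).
Proof. by do !split; rewrite -val_eqE /= !inordK. Qed.

Lemma sum3 (V : nmodType) (F : 'I_3 -> V) : \sum_i F i = F i0 + F i1 + F i2.
Proof.
rewrite !big_ord_recl big_ord0 addr0 addrA.
by congr (F _ + F _ + F _); apply: val_inj; rewrite /= inordK.
Qed.

Lemma wdeg3 (R : realFieldType) (a b c : R) m :
  wdeg (tnth [tuple a; b; c]) m = a * (m i0)%:R + b * (m i1)%:R + c * (m i2)%:R.
Proof. by rewrite /wdeg sum3 !tnth3. Qed.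

(** * Growth criteria from weights *)

Section WeightedGrowth.
Variables (R : realType) (k : fieldType).
Implicit Types (f g : endo k 3) (T : {set 'I_3}).

Lemma inj_on_pair n (g : endo k n) i j i' j' : i != j ->
  (exists2 m, m \in msupp (tnth g i) & m i' != 0%N) ->
  (forall m, m \in msupp (tnth g j) -> m i' = 0%N) ->
  (exists2 m, m \in msupp (tnth g j) & m j' != 0%N) ->
  inj_on [set i; j]%SET g.
Proof.
move=> ij gi gj gj'; apply: (@inj_on_step _ _ _ i i') => //.
- by rewrite !inE eqxx.
- by move=> l; rewrite !inE => /orP[->//|/eqP ->].
have -> : ([set i; j] :\ i = [set j])%SET.
  by apply/setP => l; rewrite !inE; case: eqP => // ->; rewrite (negbTE ij).
apply: (@inj_on_step _ _ _ j j') => //; first by rewrite inE.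
- by move=> l; rewrite inE => ->.
have -> : ([set j] :\ j = finset.set0)%SET by apply/setP => l; rewrite !inE; case: eqP.
exact: inj_on0.
Qed.

Lemma inj_on_single n (g : endo k n) i i' :
  (exists2 m, m \in msupp (tnth g i) & m i' != 0%N) -> inj_on [set i]%SET g.
Proof.
move=> gi; apply: (@inj_on_step _ _ _ i i') => //; first by rewrite inE.
- by move=> l; rewrite inE => ->.
have -> : ([set i] :\ i = finset.set0)%SET by apply/setP => l; rewrite !inE; case: eqP.
exact: inj_on0.
Qed.

Lemma mem_wpart n (mu : 'I_n -> R) D (p : {mpoly k[n]}) m :
  (m \in msupp (wpart mu D p)) = (wdeg mu m == D) && (m \in msupp p).
Proof. by rewrite !mcoeff_msupp mcoeff_wpart; case: ifP => //; rewrite eqxx. Qed.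

Lemma mem_scale_var_add n (a : k) i (q : {mpoly k[n]}) m : a != 0 ->
  (forall m, m \in msupp q -> m i = 0%N) ->
  (m \in msupp (a *: 'X_i + q)) = (m == U_(i)%MM) || (m \in msupp q).
Proof.
move=> a0 qi; have qU : q@_U_(i)%MM = 0.
  by apply/eqP; rewrite mcoeff_eq0; apply/negP => /qi; rewrite mnm1E eqxx.
rewrite !mcoeff_msupp mcoeffD mcoeffZ mcoeffX.
have [->|_] := eqVneq m U_(i)%MM; first by rewrite qU mulr1 addr0 a0.
by rewrite mulr0 add0r.
Qed.

(** Since [growth1] settles th = 1, a lower bound has to be supplied only when 1 < th. This matters
    because at th = 1 no monomial need attain the level. *)
Lemma growth_weights n (mu : 'I_n -> R) th (f : endo k n) : (0 < n)%N -> 1 <= th ->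
  is_automorphism f -> (forall i, 0 < mu i) -> (forall i, wle mu (th * mu i) (tnth f i)) ->
  (1 < th -> exists2 c, 0 < c & forall r, c * th ^+ r <= (degree (endo_iter r f))%:R) ->
  growth f th.
Proof.
move=> n0 th1 af mu0 fth lo; have th0 : 0 < th by exact: lt_le_trans th1.
have [C CP] := degree_iter_le th0 mu0 fth.
have up t : th < t -> exists C, forall r, (degree (endo_iter r f))%:R <= C * t ^+ r.
  move=> tht; exists C => r; apply: le_trans (CP r) _.
  have C0 : 0 <= C by have := le_trans (ler0n _ _) (CP 0%N); rewrite mulr1.
  by rewrite ler_wpM2l // lerXn2r ?nnegrE ?(ltW th0) ?(ltW tht) // (le_trans (ltW th0)) ?ltW.
have [th1'|] := ltP 1 th; first by split=> //; apply: lo.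
move=> th1'; have E : th = 1 by apply/eqP; rewrite eq_le th1 th1'.
by rewrite E in up *; apply: growth1.
Qed.

(* The mu-leading part of f is (G(x1,x2), c x1^e, ...): it is dominant in (x1,x2) when G
   involves x2, and otherwise G is a power of x1. *)
Lemma growth_pair (mu : 'I_3 -> R) th f : 1 <= th -> is_automorphism f ->
  (forall i, 0 < mu i) -> (forall i, wle mu (th * mu i) (tnth f i)) ->
  (1 < th ->
   [/\ forall m, m \in msupp (tnth f i0) -> wdeg mu m = th * mu i0 -> m i2 = 0%N,
       exists2 m, m \in msupp (tnth f i0) & wdeg mu m = th * mu i0,
       forall m, m \in msupp (tnth f i1) -> wdeg mu m = th * mu i1 ->
         m i1 = 0%N /\ m i2 = 0%N
     & exists2 m, m \in msupp (tnth f i1) & wdeg mu m = th * mu i1]) ->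
  growth f th.
Proof.
move=> th1 af mu0 fth lead; apply: (growth_weights _ th1 af mu0 fth) => // {}th1.
have th0 : 0 < th by exact: lt_trans th1.
have [f0 [m0 m0f m0w] f1 [m1 m1f m1w]] := lead th1.
pose g := [tuple wpart mu (th * mu i) (tnth f i) | i < 3].
have gf i : lead_at mu (th * mu i) (tnth f i) (tnth g i).
  by rewrite tnth_mktuple; apply: lead_at_wpart.
have memg m i : (m \in msupp (tnth g i)) = (wdeg mu m == th * mu i) && (m \in msupp (tnth f i)).
  by rewrite tnth_mktuple mem_wpart.
apply: (@degree_iter_ge _ _ _ mu th f g i0) => // [i|r]; first exact: ltW.
have [[m [mf mw mi]]|H] := pselect (exists m,
    [/\ m \in msupp (tnth f i0), wdeg mu m = th * mu i0 & m i1 != 0%N]).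
  apply: (@endo_iter_neq0 _ _ [set i0; i1]%SET); last by rewrite !inE eqxx.
    move=> j jT m' m'g l lT; move: l lT jT m'g; elim/ord3_ind; rewrite !inE ?eqxx ?orbT //.
    move=> _ /orP[]/eqP ->; rewrite memg => /andP[/eqP w mf']; first exact: f0.
    by have [_ ->] := f1 _ mf' w.
  apply: (@inj_on_pair _ _ _ _ i1 i0); rewrite ?ord3_eq //.
  - by exists m; rewrite // memg mw eqxx.
  - by move=> m'; rewrite memg => /andP[/eqP w mf']; have [-> _] := f1 _ mf' w.
  exists m1; first by rewrite memg m1w eqxx.
  (* Otherwise [m1] is the trivial monomial, of weight 0, while its weight th mu_2 is positive. *)
  apply/eqP => m10; have [m11 m12] := f1 _ m1f m1w.
  move: m1w; rewrite /wdeg sum3 m10 m11 m12 !mulr0 !addr0 => /eqP.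
  by rewrite eq_sym mulf_eq0 !gt_eqF.
have {}H m : m \in msupp (tnth f i0) -> wdeg mu m = th * mu i0 -> m i1 = 0%N.
  by move=> mf mw; apply/eqP; apply: contrapT => /negP mi; apply: H; exists m.
apply: (@endo_iter_neq0 _ _ [set i0]%SET); last by rewrite inE eqxx.
  move=> j; rewrite inE => /eqP -> m; rewrite memg => /andP[/eqP w mf].
  by elim/ord3_ind; rewrite !inE ?eqxx // => _; [apply: H|apply: f0].
apply: (@inj_on_single _ _ _ i0); exists m0; first by rewrite memg m0w eqxx.
apply/eqP => m00; have m01 := H _ m0f m0w; have m02 := f0 _ m0f m0w.
move: m0w; rewrite /wdeg sum3 m00 m01 m02 !mulr0 !addr0 => /eqP.
by rewrite eq_sym mulf_eq0 !gt_eqF.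
Qed.

(** The weights are forced: normalise x3 to weight 1; then c x1 in the third component gives x1
    weight th, and x1^e in the second gives x2 weight e. The first component yields the condition on
    [q]. For 1 < th the terms a x3 and b x2 lie strictly below their levels. *)
Lemma growth_main a b c e (s : k) (p q : {mpoly k[3]}) (th : R) : 
  a != 0 -> b != 0 -> c != 0 -> (0 < e)%N ->
  is_automorphism [tuple a *: 'X_i2 + q; b *: 'X_i1 + p; c *: 'X_i0 + s%:MP] ->
  (forall m, m \in msupp q -> m i2 = 0%N) ->
  (forall m, m \in msupp p -> [/\ m i1 = 0%N, m i2 = 0%N & (m i0 <= e)%N]) ->
  (exists2 m, m \in msupp p & m i0 = e) -> 1 <= th ->
  (forall m, m \in msupp q -> (m i0)%:R * th + (m i1)%:R * e%:R <= th ^+ 2) ->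
  (1 < th -> exists2 m, m \in msupp q & (m i0)%:R * th + (m i1)%:R * e%:R = th ^+ 2) ->
  growth [tuple a *: 'X_i2 + q; b *: 'X_i1 + p; c *: 'X_i0 + s%:MP] th.
Proof.
move=> a0 b0 c0 e0 af q2 pe [mp mpp mpe] th1 qth qE.
have th0 : 0 < th by exact: lt_le_trans th1.
have e0' : 0 < e%:R :> R by rewrite ltr0n.
have p1 m : m \in msupp p -> m i1 = 0%N by move=> /pe[].
apply: (@growth_pair (tnth [tuple th; e%:R; 1])) => //.
- by elim/ord3_ind; rewrite !tnth3.
- have th2 : th <= th ^+ 2 by rewrite expr2 ler_peMl // ltW.
  elim/ord3_ind => m; rewrite !tnth3.
  + rewrite mem_scale_var_add // wdeg3 => /orP[/eqP ->|mq].
      by rewrite !mnm1E !ord3_eq eqxx /= !(mulr1n, mulr0n, mulr0, mulr1, addr0, add0r); nra.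
    by have := qth m mq; rewrite q2 //; nra.
  + rewrite mem_scale_var_add // wdeg3 => /orP[/eqP ->|mp'].
      by rewrite !mnm1E !ord3_eq eqxx /= !(mulr1n, mulr0n, mulr0, mulr1, addr0, add0r); nra.
    have [-> -> /=] := pe m mp'; rewrite -(ler_nat R); nra.
  rewrite -mul_mpolyC => /msuppD_le; rewrite mem_cat mul_mpolyC => /orP[/msuppZ_le|].
    by move/mem_msuppXP => <-; rewrite wdeg3 !mnm1E !ord3_eq eqxx /= !(mulr1n, mulr0n, mulr0, mulr1, addr0, add0r); nra.
  by move/(@supp_inC _ _ (eq^~ 0%MM) s erefl) => ->; rewrite wdeg0 mulr1 ltW.
move=> th1'; split.
- move=> m; rewrite !tnth3 mem_scale_var_add // => /orP[/eqP ->|mq _]; last exact: q2.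
  rewrite wdeg3 !mnm1E !ord3_eq eqxx /= !(mulr1n, mulr0n, mulr0, mulr1, addr0, add0r) => E.
  by have : 1 < th * th; [nra|rewrite {1}E ltxx].
- have [m mq mE] := qE th1'; exists m; rewrite !tnth3.
    by rewrite mem_scale_var_add // mq orbT.
  by rewrite wdeg3 q2 //; nra.
- move=> m; rewrite !tnth3 mem_scale_var_add // => /orP[/eqP ->|/pe[] //].
  rewrite wdeg3 !mnm1E !ord3_eq eqxx /= !(mulr1n, mulr0n, mulr0, mulr1, addr0, add0r) => E.
  by have : e%:R < th * e%:R; [nra|rewrite {1}E ltxx].
exists mp; rewrite !tnth3; first by rewrite mem_scale_var_add // mpp orbT.
by have [m1 m2 _] := pe _ mpp; rewrite wdeg3 mpe m1 m2; nra.
Qed.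

End WeightedGrowth.

(** * Growth for the individual permutations *)

Section GrowthCases.
Variables (R : realType) (k : fieldType).
Implicit Types (f g : endo k 3) (T : {set 'I_3}).

Lemma supp_affine n P (c : k) (s : k) (i : 'I_n) : P U_(i)%MM -> P 0%MM ->
  supp_in P (c *: 'X_i + s%:MP).
Proof.
move=> PU P0; apply: supp_inD; last exact: supp_inC.
by apply: supp_inZ; apply: supp_inX.
Qed.

Lemma mem_affine n (c s : k) (i : 'I_n) m : c != 0 -> m \in msupp (c *: 'X_i + s%:MP) ->
  m = U_(i)%MM \/ m = 0%MM.
Proof. by move=> c0 /(@supp_affine _ (fun m => m = U_(i)%MM \/ m = 0%MM)); apply; [left|right]. Qed.

Lemma var_mem_affine n (c s : k) (i : 'I_n) : c != 0 -> U_(i)%MM \in msupp (c *: 'X_i + s%:MP).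
Proof.
by move=> c0; rewrite mcoeff_msupp mcoeffD mcoeffZ mcoeffX mcoeffC mnm1_eq0 eqxx mulr0 addr0 mulr1.
Qed.

(** With x3 of weight 1, the last two components force weight th on x2 and th^2 on x1. The
    hypothesis on [q] is the level condition of the first component divided by th. *)
Lemma growth_shift a b c s s' (q : {mpoly k[3]}) (th : R) :
  a != 0 -> b != 0 -> c != 0 ->
  is_automorphism [tuple a *: 'X_i2 + q; b *: 'X_i0 + s%:MP; c *: 'X_i1 + s'%:MP] ->
  (forall m, m \in msupp q -> m i2 = 0%N) -> 1 <= th ->
  (forall m, m \in msupp q -> (m i0)%:R * th + (m i1)%:R <= th ^+ 2) ->
  (1 < th -> exists2 m, m \in msupp q & (m i0)%:R * th + (m i1)%:R = th ^+ 2) ->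
  growth [tuple a *: 'X_i2 + q; b *: 'X_i0 + s%:MP; c *: 'X_i1 + s'%:MP] th.
Proof.
move=> a0 b0 c0 af q2 th1 qth qE.
have th0 : 0 < th by exact: lt_le_trans th1.
have th2 : th <= th ^+ 2 by rewrite expr2 ler_peMl // ltW.
have th3 : th <= th ^+ 3 by rewrite exprS ler_peMr ?(ltW th0) // (le_trans th1).
apply: (@growth_pair _ _ (tnth [tuple th ^+ 2; th; 1])) => //.
- by elim/ord3_ind; rewrite !tnth3 ?exprn_gt0.
- elim/ord3_ind => m; rewrite !tnth3.
  + rewrite mem_scale_var_add // wdeg3 => /orP[/eqP ->|mq].
      by rewrite !mnm1E !ord3_eq eqxx /= !(mulr1n, mulr0n, mulr0, mulr1, addr0, add0r) -exprS (le_trans th1).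
    have := qth m mq; rewrite q2 // mulr0 addr0 => h.
    have -> : th ^+ 2 * (m i0)%:R + th * (m i1)%:R = th * ((m i0)%:R * th + (m i1)%:R) by ring.
    by rewrite ler_pM2l.
  + case/mem_affine => // ->; last by rewrite wdeg0 -expr2 exprn_ge0 // ltW.
    by rewrite wdeg3 !mnm1E !ord3_eq eqxx /= !(mulr1n, mulr0n, mulr0, mulr1, addr0, add0r) expr2.
  case/mem_affine => // ->; last by rewrite wdeg0 mulr1 ltW.
  by rewrite wdeg3 !mnm1E !ord3_eq eqxx /= !(mulr1n, mulr0n, mulr0, mulr1, addr0, add0r).
move=> th1'; split.
- move=> m; rewrite !tnth3 mem_scale_var_add // => /orP[/eqP ->|mq _]; last exact: q2.
  rewrite wdeg3 !mnm1E !ord3_eq eqxx /= !(mulr1n, mulr0n, mulr0, mulr1, addr0, add0r) -exprS => E.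
  by move: (lt_le_trans th1' th3); rewrite -E ltxx.
- have [m mq mE] := qE th1'; exists m; rewrite !tnth3.
    by rewrite mem_scale_var_add // mq orbT.
  by rewrite wdeg3 q2 // mulr0 addr0 -[in RHS]mE; ring.
- move=> m; rewrite !tnth3 => /mem_affine[] // ->; first by rewrite !mnm1E !ord3_eq.
  by rewrite !mnm0E.
exists U_(i0)%MM; rewrite !tnth3; first exact: var_mem_affine.
by rewrite wdeg3 !mnm1E !ord3_eq eqxx /= !(mulr1n, mulr0n, mulr0, mulr1, addr0, add0r) expr2.
Qed.

(** The first two components form a map of the plane of Henon type, with weights (e, 1). The third
    coordinate lies over this plane and gets the weight d e, large enough that [q] does not exceed
    its level. *)
Lemma growth_henon a b c s e (p q : {mpoly k[3]}) :
  a != 0 -> b != 0 -> c != 0 -> (0 < e)%N ->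
  is_automorphism [tuple b *: 'X_i1 + p; c *: 'X_i0 + s%:MP; a *: 'X_i2 + q] ->
  (forall m, m \in msupp q -> m i2 = 0%N) ->
  (forall m, m \in msupp p -> [/\ m i1 = 0%N, m i2 = 0%N & (m i0 <= e)%N]) ->
  ((1 < e)%N -> exists2 m, m \in msupp p & m i0 = e) ->
  growth [tuple b *: 'X_i1 + p; c *: 'X_i0 + s%:MP; a *: 'X_i2 + q] (e%:R : R).
Proof.
move=> a0 b0 c0 e0 af q2 pe pE.
(* The successor keeps [d] positive when q = 0. *)
pose d := (msize q).+1; have qd m : m \in msupp q -> (m i0 + m i1 <= d)%N.
  move=> mq; have := msize_mdeg_lt mq; rewrite mdegE sum3 => h.
  by apply/ltnW/ltnW; apply: leq_ltn_trans h; rewrite leq_addr.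
have p1 m : m \in msupp p -> m i1 = 0%N by move=> /pe[].
have e1 : 1 <= e%:R :> R by rewrite ler1n.
have e0' : 0 < e%:R :> R by rewrite ltr0n.
have d1 : 1 <= d%:R :> R by rewrite ler1n.
apply: (@growth_pair _ _ (tnth [tuple e%:R; 1; d%:R * e%:R])) => //.
- by elim/ord3_ind; rewrite !tnth3 // mulr_gt0 // (lt_le_trans ltr01).
- elim/ord3_ind => m; rewrite !tnth3.
  + rewrite mem_scale_var_add // wdeg3 => /orP[/eqP ->|mp].
      by rewrite !mnm1E !ord3_eq eqxx /= !(mulr1n, mulr0n, mulr0, mulr1, addr0, add0r); nra.
    have [-> -> me] := pe m mp; rewrite !mulr0 !addr0 ler_pM2l //.
    by rewrite ler_nat.
  + case/mem_affine => // ->; last by rewrite wdeg0 mulr1 ltW.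
    by rewrite wdeg3 !mnm1E !ord3_eq eqxx /= !(mulr1n, mulr0n, mulr0, mulr1, addr0, add0r).
  rewrite mem_scale_var_add // wdeg3 => /orP[/eqP ->|mq].
    by rewrite !mnm1E !ord3_eq eqxx /= !(mulr1n, mulr0n, mulr0, mulr1, addr0, add0r) ler_peMl // mulr_ge0.
  rewrite (q2 m mq) mulr0 addr0; have := qd m mq; rewrite -(ler_nat R) natrD.
  move: (ler0n R (m i0)) (ler0n R (m i1)).
  move: (m i0)%:R (m i1)%:R d%:R e%:R d1 e1 => x y D E D1 E1 x0 y0 xy.
  have h1 : E * x + 1 * y <= E * (x + y) by nra.
  have h2 : E * (x + y) <= E * D by rewrite ler_pM2l //; lra.
  have h3 : E * D <= E * (D * E) by rewrite ler_pM2l ?ler_peMr //; lra.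
  exact: le_trans h1 (le_trans h2 h3).
rewrite ltr1n => e2; split.
- move=> m; rewrite !tnth3 mem_scale_var_add // => /orP[/eqP ->|/pe[] //].
  by rewrite !mnm1E !ord3_eq.
- have [m mp mE] := pE e2; have [m1 m2 _] := pe m mp; exists m; rewrite !tnth3.
    by rewrite mem_scale_var_add // mp orbT.
  by rewrite wdeg3 m1 m2 mE; ring.
- move=> m; rewrite !tnth3 => /mem_affine[] // ->; first by rewrite !mnm1E !ord3_eq.
  by rewrite !mnm0E.
exists U_(i0)%MM; rewrite !tnth3; first exact: var_mem_affine.
by rewrite wdeg3 !mnm1E !ord3_eq eqxx /= !(mulr1n, mulr0n, mulr0, mulr1, addr0, add0r).
Qed.

(** The weights 1, d, d^2 increase so fast that [p] and [q] weigh no more than x2 and x3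
    respectively; the degrees of the iterates stay bounded. *)
Lemma growth_triangular a b c s (p q : {mpoly k[3]}) :
  a != 0 -> b != 0 -> c != 0 ->
  is_automorphism [tuple c *: 'X_i0 + s%:MP; b *: 'X_i1 + p; a *: 'X_i2 + q] ->
  (forall m, m \in msupp q -> m i2 = 0%N) ->
  (forall m, m \in msupp p -> m i1 = 0%N /\ m i2 = 0%N) ->
  growth [tuple c *: 'X_i0 + s%:MP; b *: 'X_i1 + p; a *: 'X_i2 + q] (1 : R).
Proof.
move=> a0 b0 c0 af q2 p12.
pose d := (maxn (msize p) (msize q)).+1.
have pd m : m \in msupp p -> (m i0 <= d)%N.
  move=> mq; have := msize_mdeg_lt mq; rewrite mdegE sum3 /d; lia.
have qd m : m \in msupp q -> (m i0 + m i1 <= d)%N.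
  move=> mq; have := msize_mdeg_lt mq; rewrite mdegE sum3 /d; lia.
have p1 m : m \in msupp p -> m i1 = 0%N by move=> /p12[].
have d1 : 1 <= d%:R :> R by rewrite ler1n.
apply: (@growth_weights _ _ _ (tnth [tuple 1; d%:R; d%:R * d%:R])) => //; last by rewrite ltxx.
  by elim/ord3_ind; rewrite !tnth3 // ?mulr_gt0 // (lt_le_trans ltr01).
elim/ord3_ind => m; rewrite !tnth3.
- case/mem_affine => // ->; last by rewrite wdeg0 mulr1.
  by rewrite wdeg3 !mnm1E !ord3_eq eqxx /= !(mulr1n, mulr0n, mulr0, mulr1, addr0, add0r).
- rewrite mem_scale_var_add // wdeg3 => /orP[/eqP ->|mp].
    by rewrite !mnm1E !ord3_eq eqxx /= !(mulr1n, mulr0n, mulr0, mulr1, addr0, add0r) mul1r.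
  by have [-> ->] := p12 m mp; rewrite !mulr0 !addr0 !mul1r ler_nat pd.
rewrite mem_scale_var_add // wdeg3 => /orP[/eqP ->|mq].
  by rewrite !mnm1E !ord3_eq eqxx /= !(mulr1n, mulr0n, mulr0, mulr1, addr0, add0r) mul1r.
rewrite (q2 m mq) mulr0 addr0; have := qd m mq; rewrite -(ler_nat R) natrD.
move: (ler0n R (m i0)) (ler0n R (m i1)).
move: (m i0)%:R (m i1)%:R d%:R d1 => x y D D1 x0 y0 xy.
have h1 : 1 * x + D * y <= D * (x + y) by nra.
have h2 : D * (x + y) <= D * D by rewrite ler_pM2l //; lra.
by rewrite [leRHS]mul1r; exact: le_trans h1 h2.
Qed.

(* The weight of the affine coordinate has to be 0 for the lower bound and positive for the
   upper one, so the upper bound only holds with any t > max(1,e) in place of max(1,e). *)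
Lemma growth_skew (f : endo k 3) (v : bool) a b c s e (p q : {mpoly k[3]}) :
  let i : 'I_3 := inord v in let j : 'I_3 := inord (~~ v) in
  a != 0 -> b != 0 -> c != 0 -> is_automorphism f ->
  tnth f i = c *: 'X_i + s%:MP -> tnth f j = a *: 'X_i2 + q -> tnth f i2 = b *: 'X_j + p ->
  (forall m, m \in msupp q -> m i2 = 0%N /\ (m j <= e)%N) ->
  (forall m, m \in msupp p -> m j = 0%N /\ m i2 = 0%N) ->
  (0 < e)%N -> ((1 < e)%N -> exists2 m, m \in msupp q & m j = e) ->
  growth f (e%:R : R).
Proof.
move=> i j a0 b0 c0 af fi fj f2 qe p0 e0 qE.
(* [v] tells which of x1 and x2 is the affine coordinate: x1 for the transposition of x2 and x3, x2
   for that of x1 and x3 when p is constant. *)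
have [ij ii2 ji2] : [/\ i != j, i != i2 & j != i2].
  by rewrite /i /j; case: (v); rewrite /= !ord3_eq.
have ord_cases l : [\/ l = i, l = j | l = i2].
  move: l; rewrite /i /j; case: (v); elim/ord3_ind => /=;
    by [apply: Or31|apply: Or32|apply: Or33].
have wd (mu : 'I_3 -> R) m : wdeg mu m = mu i * (m i)%:R + mu j * (m j)%:R + mu i2 * (m i2)%:R.
  rewrite /wdeg sum3 /i /j; case: (v) => //=.
  by rewrite [X in X + _ = _]addrC.
have q2 m : m \in msupp q -> m i2 = 0%N by move=> /qe[].
have pj m : m \in msupp p -> m j = 0%N by move=> /p0[].
have e1 : 1 <= e%:R :> R by rewrite ler1n.
have U_E (l l' : 'I_3) : (U_(l)%MM : 'X_{1..3}) l' = (l == l') by rewrite mnm1E.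
pose d := (maxn (msize p) (msize q)).+1.
have pd m : m \in msupp p -> (m i <= d)%N.
  move=> mq; have := msize_mdeg_lt mq; rewrite mdegE (bigD1 i) //= /d; lia.
have qd m : m \in msupp q -> (m i <= d)%N.
  move=> mq; have := msize_mdeg_lt mq; rewrite mdegE (bigD1 i) //= /d; lia.
have d0 : 0 < d%:R :> R by rewrite ltr0n.
have up (t : R) : e%:R < t -> exists C : R, forall r, (degree (endo_iter r f))%:R <= C * t ^+ r.
  (* With this weight on x_i, the power of x_i in any monomial of [p] or [q] weighs at most t - e,
     exactly the room left above x_j^e. *)
  move=> et; pose eps := (t - e%:R) / d%:R.
  have t1 : 1 < t by exact: le_lt_trans e1 et.
  have eps0 : 0 < eps by rewrite divr_gt0 // subr_gt0.
  have epsd (x : nat) : (x <= d)%N -> eps * x%:R <= t - e%:R.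
    by move=> xd; rewrite -[leRHS](divfK (lt0r_neq0 d0)) -/eps ler_pM2l // ler_nat.
  apply: (@degree_iter_le _ _ _ (fun l => if l == i then eps else 1)).
  - exact: lt_trans t1.
  - by move=> l; case: ifP.
  move=> l m; rewrite wd eqxx ![_ == i]eq_sym (negbTE ij) (negbTE ii2).
  case: (ord_cases l) => ->.
  - rewrite fi eqxx => /mem_affine[] // ->.
      rewrite !U_E eqxx (negbTE ij) (negbTE ii2) /= mulr1 !mulr0 !addr0.
      by rewrite ler_peMl // ltW.
    by rewrite !mnm0E !mulr0 !addr0 mulr_ge0 // ltW // (lt_trans ltr01).
  - rewrite fj (negbTE ij) mem_scale_var_add // => /orP[/eqP ->|mq].
      rewrite !U_E eqxx ![i2 == _]eq_sym (negbTE ii2) (negbTE ji2) /= !mulr1n !mulr0n !mulr0 !add0r !mulr1.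
      exact: ltW.
    have [-> mj] := qe m mq; have := epsd _ (qd m mq); move: mj; rewrite -(ler_nat R).
    by move=> h1 h2; lra.
  rewrite f2 (negbTE ii2) mem_scale_var_add // => /orP[/eqP ->|mp].
    rewrite !U_E eqxx [j == i]eq_sym (negbTE ij) (negbTE ji2) /= !mulr0 add0r addr0 !mulr1.
    exact: ltW.
  have [-> ->] := p0 m mp; have := epsd _ (pd m mp); lra.
have [e2|] := ltnP 1 e; last first.
  move=> e1'; have E : e = 1%N by lia.
  by rewrite E in up *; apply: growth1.
have {}qE := qE e2; split=> //.
(* The limiting weights: 0 on x_i, 1 on x3, and e on x_j because the third component is led by x_j
   at level e. *)
pose mu l : R := if l == i then 0 else if l == j then e%:R else 1.
have mui : mu i = 0 by rewrite /mu eqxx.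
have muj : mu j = e%:R by rewrite /mu [j == i]eq_sym (negbTE ij) eqxx.
have mu2 : mu i2 = 1 by rewrite /mu ![i2 == _]eq_sym (negbTE ii2) (negbTE ji2).
have e0' : 0 < e%:R :> R by rewrite ltr0n.
have e2' : 1 < e%:R :> R by rewrite ltr1n.
have fw l : wle mu (e%:R * mu l) (tnth f l).
  move=> m; rewrite wd mui muj mu2 mul0r add0r mul1r.
  case: (ord_cases l) => ->; rewrite ?mui ?muj ?mu2.
  - rewrite fi => /mem_affine[] // ->.
      by rewrite !U_E (negbTE ij) (negbTE ii2) /= !mulr0 !addr0.
    by rewrite !mnm0E !mulr0 !addr0.
  - rewrite fj mem_scale_var_add // => /orP[/eqP ->|mq].
      rewrite !U_E eqxx [i2 == _]eq_sym (negbTE ji2) /= mulr0 add0r.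
      nra.
    have [-> mj] := qe m mq; rewrite addr0 ler_pM2l //.
    by rewrite ler_nat.
  rewrite f2 mem_scale_var_add // => /orP[/eqP ->|mp].
    by rewrite !U_E eqxx (negbTE ji2) /= !mulr1 addr0.
  by have [-> ->] := p0 m mp; rewrite mulr0 addr0 mulr1 ltW.
pose g := [tuple wpart mu (e%:R * mu l) (tnth f l) | l < 3].
have gf l : lead_at mu (e%:R * mu l) (tnth f l) (tnth g l).
  by rewrite tnth_mktuple; apply: lead_at_wpart.
have memg m l : (m \in msupp (tnth g l)) = (wdeg mu m == e%:R * mu l) && (m \in msupp (tnth f l)).
  by rewrite tnth_mktuple mem_wpart.
(* In the j-th component the term a x3 has weight 1, below the level e^2, so the leading map
   preserves the polynomials in x_i and x_j. *)
have gi2 l : l != i2 -> forall m, m \in msupp (tnth g l) -> m i2 = 0%N.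
  move=> l2 m; rewrite memg wd mui muj mu2 mul0r add0r mul1r => /andP[/eqP].
  case: (ord_cases l) l2 => ->; rewrite ?eqxx ?mui ?muj // => _.
    by move=> _; rewrite fi => /mem_affine[] // ->; rewrite ?mnm0E // mnm1E (negbTE ii2).
  rewrite fj mem_scale_var_add // => w /orP[/eqP E|mq]; last exact: q2.
  move: w; rewrite E !U_E eqxx [i2 == _]eq_sym (negbTE ji2) /= mulr0 add0r => E'.
  by have : 1 < e%:R * e%:R :> R; [nra|rewrite -E' ltxx].
have gij m : m \in msupp (tnth g i) -> m j = 0%N.
  rewrite memg fi => /andP[_] /mem_affine[] // ->; rewrite ?mnm0E // mnm1E.
  by rewrite (negbTE ij).
apply: (@degree_iter_ge _ _ _ mu e%:R f g j) => // [l||r].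
- by rewrite /mu; case: ifP => // _; case: ifP.
- by rewrite muj.
apply: (@endo_iter_neq0 _ _ [set j; i]%SET); last by rewrite !inE eqxx.
  move=> l lT m mg l'; case: (ord_cases l') => ->; rewrite !inE ?eqxx ?orbT // => _.
  apply: gi2 mg; move: lT; rewrite !inE => /orP[/eqP ->|/eqP ->] //.
apply: (@inj_on_pair _ _ _ _ _ j i); rewrite 1?eq_sym //.
- have [m mq mj] := qE; exists m; last by rewrite mj -lt0n.
  rewrite memg wd mui muj mu2 mj q2 // mul0r add0r mulr0 addr0 eqxx fj.
  by rewrite mem_scale_var_add // mq orbT.
exists U_(i)%MM; last by rewrite mnm1E eqxx.
rewrite memg wdeg1 mui mulr0 eqxx fi /=; exact: var_mem_affine.
Qed.

End GrowthCases.

(** * The quadratic numbers *)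

Section QuadraticValue.
Variable R : realType.
Implicit Types (th : R) (a b c d : nat).

Lemma quadratic_value_root a b c :
  a%:R * quadratic_value R a b c + b%:R * c%:R = quadratic_value R a b c ^+ 2.
Proof.
have h : Num.sqrt (a%:R ^+ 2 + 4 * b%:R * c%:R) ^+ 2 = a%:R ^+ 2 + 4 * b%:R * c%:R :> R.
  by rewrite sqr_sqrtr // addr_ge0 ?sqr_ge0 // !mulr_ge0.
rewrite /quadratic_value; move: h; set s := Num.sqrt _ => h.
have -> : ((a%:R + s) / 2) ^+ 2 = (a%:R ^+ 2 + 2 * a%:R * s + s ^+ 2) / 4 by field.
by rewrite h; field.
Qed.

Lemma quadratic_valueE a b c th : 0 < th -> a%:R * th + b%:R * c%:R = th ^+ 2 ->
  th = quadratic_value R a b c.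
Proof.
move=> th0 E; rewrite /quadratic_value.
have bc0 : 0 <= b%:R * c%:R :> R by rewrite mulr_ge0.
have -> : a%:R ^+ 2 + 4 * b%:R * c%:R = (2 * th - a%:R) ^+ 2.
  have h : b%:R * c%:R = th ^+ 2 - a%:R * th by rewrite -E; ring.
  by rewrite -mulrA h; ring.
(* This selects the sign of the square root, which is 2 th - a. *)
have ath : a%:R <= th by nra.
by rewrite sqrtr_sqr ger0_norm; [field|lra].
Qed.

Lemma quadratic_value_gt a b c th : 0 <= th -> th ^+ 2 < a%:R * th + b%:R * c%:R ->
  th < quadratic_value R a b c.
Proof.
move=> th0 lt; rewrite /quadratic_value ltr_pdivlMr // -ltrBlDl.
have [h|h] := ltP (th * 2 - a%:R) 0.
  by apply: lt_le_trans h _; apply: sqrtr_ge0.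
rewrite -(ger0_norm h) -sqrtr_sqr ltr_sqrt; first by nra.
by have := ler0n R a; have := ler0n R b; have := ler0n R c; nra.
Qed.

(** Integrality is at work: a nonzero root of t^2 = a t + b c has a >= 1 or b c >= 1. *)
Lemma quadratic_value_ge1 a b c : quadratic_value R a b c != 0 -> 1 <= quadratic_value R a b c.
Proof.
have := quadratic_value_root a b c; have : 0 <= quadratic_value R a b c.
  by rewrite divr_ge0 // addr_ge0 // sqrtr_ge0.
move: (quadratic_value R a b c) => q q0 E qn0.
have q0' : 0 < q by rewrite lt_neqAle eq_sym qn0.
case: a E => [|a] E.
  have bc1 : (1 <= b * c)%N.
    rewrite lt0n; apply: contraNneq qn0 => bc; move: E.
    by rewrite mul0r add0r -natrM bc => /esym /eqP; rewrite expf_eq0.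
  have : 1 <= q ^+ 2 by rewrite -E mul0r add0r -natrM ler1n.
  by nra.
have a1 : 1 <= a.+1%:R :> R by rewrite ler1n.
have bc0 : 0 <= b%:R * c%:R :> R by rewrite mulr_ge0.
by nra.
Qed.

Lemma quadratic_value0 a b : quadratic_value R a b 0 = a%:R.
Proof.
by rewrite /quadratic_value mulr0 addr0 sqrtr_sqr normr_nat; field.
Qed.

(** th is the largest among 1 and the roots attached to the monomials of the list. A monomial that
    exceeds th^2 at th has a larger root, and replacing th by it preserves the earlier
    inequalities. *)
Lemma ex_dominant_root c (s : seq 'X_{1..3}) : exists th, [/\ 1 <= th,
  forall m, m \in s -> (m i0)%:R * th + (m i1)%:R * c%:R <= th ^+ 2
  & 1 < th -> exists2 m, m \in s & (m i0)%:R * th + (m i1)%:R * c%:R = th ^+ 2].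
Proof.
elim: s => [|m s [th [th1 ths thE]]].
  by exists 1; split=> //; rewrite ltxx.
have th0 : 0 <= th by exact: le_trans th1.
have [h|h] := leP ((m i0)%:R * th + (m i1)%:R * c%:R) (th ^+ 2).
  exists th; split=> // [m'|/thE[m' m's E]].
    by rewrite inE => /orP[/eqP ->|/ths].
  by exists m' => //; rewrite inE m's orbT.
have lt := quadratic_value_gt th0 h; have qE := quadratic_value_root (m i0) (m i1) c.
exists (quadratic_value R (m i0) (m i1) c); split=> [|m'|_].
- exact: le_trans th1 (ltW lt).
- rewrite inE => /orP[/eqP -> |/ths]; first by rewrite qE.
  have : 0 <= (m' i1)%:R * c%:R :> R by rewrite mulr_ge0.
  have := ler0n R (m' i0); move: lt th1; clear; move: (quadratic_value _ _ _ _) => q.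
  move: (m' i0)%:R (_ * c%:R) => x y lt th1 x0 y0 h.
  (* As y >= 0, the inequality at th gives x <= th, and t^2 - x t is increasing for t >= th. *)
  have xth : x <= th by rewrite -(ler_pM2r (lt_le_trans ltr01 th1)) -expr2; lra.
  have : 0 <= (q - th) * (q + th - x) by rewrite mulr_ge0; lra.
  nra.
by exists m; rewrite ?mem_head.
Qed.

Definition quadratic_degree d th :=
  exists a b c, [/\ (a + b <= d)%N, (c <= d)%N & th = quadratic_value R a b c].

Lemma quadratic_degree_nat d e : (e <= d)%N -> quadratic_degree d e%:R.
Proof. by move=> ed; exists e, 0%N, 0%N; rewrite addn0 quadratic_value0. Qed.

Lemma quadratic_degree_monomial d c th (m : 'X_{1..3}) : 0 < th ->
  (m i0 + m i1 <= d)%N -> (c <= d)%N ->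
  (m i0)%:R * th + (m i1)%:R * c%:R = th ^+ 2 -> quadratic_degree d th.
Proof. by move=> th0 md cd /(quadratic_valueE th0) ->; exists (m i0), (m i1), c. Qed.

End QuadraticValue.

(** * Polynomial conjugations and the first 3-cycle *)

Section Cases.
Variables (R : realType) (k : fieldType).
Implicit Types (a b c s : k) (p q : {mpoly k[3]}) (d e : nat) (th : R).

Lemma endo_comp3 (x y z : {mpoly k[3]}) (G : endo k 3) :
  endo_comp [tuple x; y; z] G = [tuple x \mPo G; y \mPo G; z \mPo G].
Proof.
by apply: eq_from_tnth; elim/ord3_ind; rewrite tnth_endo_comp !tnth3.
Qed.

Lemma endo_id3 : endo_id k 3 = [tuple 'X_i0; 'X_i1; 'X_i2].
Proof. by apply: eq_from_tnth; elim/ord3_ind; rewrite tnth_endo_id !tnth3. Qed.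

Lemma comp_scale_var_add a i q (G : endo k 3) :
  (a *: 'X_i + q) \mPo G = a *: tnth G i + (q \mPo G).
Proof. by rewrite comp_mpolyD comp_mpolyZ comp_mpoly_var. Qed.

(** Slots that p does not see are normalised to 0, so that equal compositions become syntactically
    equal. *)
Lemma comp_on_var0 p (x y z : {mpoly k[3]}) : (forall m, m \in msupp p -> m i1 = 0%N /\ m i2 = 0%N) ->
  p \mPo [tuple x; y; z] = p \mPo [tuple x; 0; 0].
Proof.
move=> p12; apply: (@eq_comp_on _ _ [set i0]%SET) => [m mp|j].
  by elim/ord3_ind; rewrite !inE ?eqxx // => _; case: (p12 m mp).
by rewrite inE => /eqP ->; rewrite !tnth3.
Qed.

Lemma comp_on_var01 q (x y z : {mpoly k[3]}) : (forall m, m \in msupp q -> m i2 = 0%N) ->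
  q \mPo [tuple x; y; z] = q \mPo [tuple x; y; 0].
Proof.
move=> q2; apply: (@eq_comp_on _ _ [set i0; i1]%SET) => [m mq|j].
  by elim/ord3_ind; rewrite !inE ?eqxx ?orbT // => _; apply: q2.
by rewrite !inE => /orP[]/eqP ->; rewrite !tnth3.
Qed.

Lemma comp_var0_id p : (forall m, m \in msupp p -> m i1 = 0%N /\ m i2 = 0%N) ->
  p \mPo [tuple 'X_i0; 0; 0] = p.
Proof. by move=> p12; rewrite -(@comp_on_var0 _ _ 'X_i1 'X_i2) // -endo_id3 comp_mpoly_id. Qed.

Lemma comp_var01_id q : (forall m, m \in msupp q -> m i2 = 0%N) ->
  q \mPo [tuple 'X_i0; 'X_i1; 0] = q.
Proof. by move=> q2; rewrite -(@comp_on_var01 _ _ _ 'X_i2) // -endo_id3 comp_mpoly_id. Qed.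

Lemma growth_transport (h h' F G : endo k 3) th :
  endo_comp h h' = endo_id k 3 -> endo_comp h' h = endo_id k 3 ->
  F = endo_comp h (endo_comp G h') -> is_automorphism F ->
  (is_automorphism G -> growth G th) -> growth F th.
Proof.
move=> hh' h'h FE aF gG; rewrite FE; apply: growth_conj => //; apply: gG.
have -> : G = endo_comp h' (endo_comp F h).
  rewrite FE -!(endo_compA h) -(endo_compA G) h'h endo_compf1 endo_compA h'h.
  by rewrite endo_comp1f.
apply: is_automorphism_comp; first by exists h.
by apply: is_automorphism_comp aF _; exists h'.
Qed.

(** The degree in 'X_i, with value 0 for p = 0; this is why attainment is only claimed for positive
    [e]. *)
Lemma ex_max_exponent p i : exists e, (forall m, m \in msupp p -> (m i <= e)%N) /\
  ((0 < e)%N -> exists2 m, m \in msupp p & m i = e).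
Proof.
elim: (msupp p) => [|m s [e [se eE]]]; first by exists 0%N.
have [h|h] := leqP (m i) e.
  exists e; split=> [m'|/eE[m' m's E]]; first by rewrite inE => /orP[/eqP ->|/se].
  by exists m' => //; rewrite inE m's orbT.
exists (m i); split=> [m'|_]; last by exists m; rewrite ?mem_head.
by rewrite inE => /orP[/eqP ->//|/se h']; apply: leq_trans h' (ltnW h).
Qed.

(** The second component determines x1, so p(x1) can be rewritten as u(c x1 + s) with u(x2) = p((x2
    - s)/c). Conjugation by x3 + u(x2) then moves [p] into the first component, where it becomes a
    u(x2). Since u has degree at most that of [p], the new polynomial [Q] still has degree at most
    [d]. *)
Lemma growth_cycle1 d a b c s p q :
  a != 0 -> b != 0 -> c != 0 ->
  is_automorphism [tuple a *: 'X_i2 + q; c *: 'X_i0 + s%:MP; b *: 'X_i1 + p] -> (0 < d)%N ->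
  (forall m, m \in msupp q -> m i2 = 0%N /\ (m i0 + m i1 <= d)%N) ->
  (forall m, m \in msupp p -> [/\ m i1 = 0%N, m i2 = 0%N & (m i0 <= d)%N]) ->
  exists th, quadratic_degree d th /\
    growth [tuple a *: 'X_i2 + q; c *: 'X_i0 + s%:MP; b *: 'X_i1 + p] th.
Proof.
move=> a0 b0 c0 aF d0 qd pd.
pose z : {mpoly k[3]} := c^-1 *: ('X_i1 - s%:MP).
pose Z : endo k 3 := [tuple z; 0; 0]; pose u := p \mPo Z.
have p12 m : m \in msupp p -> m i1 = 0%N /\ m i2 = 0%N by move=> /pd[].
have q2 m : m \in msupp q -> m i2 = 0%N by move=> /qd[].
have u1 : supp_on [set i1]%SET u.
  apply: (@supp_on_comp _ _ [set i0]%SET) => [m /p12[m1 m2]|j].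
    by elim/ord3_ind; rewrite !inE ?eqxx.
  rewrite inE => /eqP ->; rewrite !tnth3; apply: supp_inZ; apply: supp_inB.
    by apply: supp_on_var; rewrite inE.
  exact: supp_onC.
have u02 m : m \in msupp u -> m i0 = 0%N /\ m i2 = 0%N.
  by move=> mu; split; apply: (u1 m mu); rewrite inE ord3_eq.
have ud m : m \in msupp u -> (m i1 <= d)%N.
  have z1 : (degree Z <= 1)%N.
    apply: degree_le; elim/ord3_ind => m'; rewrite !tnth3 ?msupp0 //; move: m'.
    apply: supp_inZ; apply: supp_inB; first by apply: supp_inX; rewrite mdeg1.
    by apply: supp_inC; rewrite mdeg0.
  move=> mu; have [m' mp'] := mdeg_comp mu; have [m1 m2 md] := pd m' mp'.
  rewrite !mdegE !sum3 m1 m2; have [-> ->] := u02 m mu.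
  move: (degree _) z1 => D D1 h; nia.
pose Q := q + a *: u.
have Qd m : m \in msupp Q -> m i2 = 0%N /\ (m i0 + m i1 <= d)%N.
  move=> /msuppD_le; rewrite mem_cat => /orP[/qd//|/msuppZ_le mu].
  by have [-> ->] := u02 m mu; split=> //; apply: ud.
have [th [th1 Qth QE]] := ex_dominant_root R 1 (msupp Q).
exists th; split.
  have [/QE[m mQ mE]|th1'] := ltP 1 th; last first.
    have -> : th = 1%:R by apply/eqP; rewrite eq_le th1 th1'.
    exact: quadratic_degree_nat.
  have [_ md] := Qd m mQ.
  by apply: (quadratic_degree_monomial (lt_le_trans ltr01 th1) md d0).
pose h : endo k 3 := [tuple 'X_i0; 'X_i1; 1 *: 'X_i2 + u].
pose h' : endo k 3 := [tuple 'X_i0; 'X_i1; 1 *: 'X_i2 - u].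
have uX x : u \mPo [tuple 'X_i0; 'X_i1; x] = u.
  rewrite -[RHS]comp_mpoly_id -/(endo_id k 3) endo_id3; apply: eq_comp_on u1 _ => j.
  by rewrite inE => /eqP ->; rewrite !tnth3.
have zE y : z \mPo [tuple y; c *: 'X_i0 + s%:MP; b *: 'X_i1] = 'X_i0.
  rewrite /z comp_mpolyZ comp_mpolyB comp_mpolyC comp_mpoly_var !tnth3 addrK.
  by rewrite scalerA mulVf // scale1r.
apply: (@growth_transport h h' _
  [tuple a *: 'X_i2 + Q; c *: 'X_i0 + s%:MP; b *: 'X_i1 + 0%:MP]) => //.
- rewrite endo_comp3 !comp_scale_var_add !comp_mpoly_var !tnth3 endo_id3 uX.
  by rewrite !scale1r subrK.
- rewrite endo_comp3 comp_mpolyB comp_mpolyZ !comp_mpoly_var !tnth3 endo_id3 uX.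
  by rewrite !scale1r addrK.
- have -> : endo_comp [tuple a *: 'X_i2 + Q; c *: 'X_i0 + s%:MP; b *: 'X_i1 + 0%:MP] h' =
      [tuple a *: 'X_i2 + q; c *: 'X_i0 + s%:MP; b *: 'X_i1].
    rewrite endo_comp3 !comp_scale_var_add !tnth3 !comp_mpolyC mpolyC0 addr0.
    rewrite [Q \mPo _]comp_mpolyD comp_mpolyZ uX comp_on_var01 ?comp_var01_id //.
    by rewrite scale1r scalerBr addrCA addrC subrK addrC.
  rewrite endo_comp3 comp_scale_var_add !comp_mpoly_var !tnth3 scale1r.
  by rewrite /u comp_mpolyA /Z endo_comp3 zE !comp_mpoly0 comp_var0_id.
move=> aG; apply: (@growth_shift _ _ a c b s 0 Q th) => //.
- by move=> m /Qd[].
- by move=> m /Qth; rewrite mulr1.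
by move=> /QE[m mQ]; rewrite mulr1; exists m.
Qed.

End Cases.

(** * The second 3-cycle *)

Section Cycle2.
Variables (R : realType) (k : fieldType).
Implicit Types (a b c s : k) (p q : {mpoly k[3]}) (d e : nat) (th : R).

(* In the coordinates X = b x2 + p(x1), Y = x1, the map (b x2 + p(x1), a x3 + q(x1,x2), ...)
   becomes (a b x3 + Q(X,Y), X, ...) with the following Q. *)
Definition conj_poly b p q : {mpoly k[3]} :=
  b *: (q \mPo [tuple 'X_i1; b^-1 *: ('X_i0 - (p \mPo [tuple 'X_i1; 0; 0])); 0]) + p.

Lemma supp_conj_poly b p q :
  (forall m, m \in msupp p -> m i1 = 0%N /\ m i2 = 0%N) ->
  (forall m, m \in msupp q -> m i2 = 0%N) ->
  supp_on [set i0; i1]%SET (conj_poly b p q).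
Proof.
move=> p12 q2; apply: supp_inD; last first.
  move=> m /p12[m1 m2]; elim/ord3_ind; rewrite !inE ?eqxx ?orbT //.
apply: supp_inZ; apply: (@supp_on_comp _ _ [set i0; i1]%SET) => [m mq|j].
  by elim/ord3_ind; rewrite !inE ?eqxx ?orbT // => _; apply: q2.
rewrite !inE => /orP[]/eqP ->; rewrite !tnth3; first by apply: supp_on_var; rewrite !inE eqxx orbT.
apply: supp_inZ; apply: supp_inB; first by apply: supp_on_var; rewrite !inE eqxx.
apply: (@supp_on_comp _ _ [set i0]%SET) => [m /p12[m1 m2]|l].
  by elim/ord3_ind; rewrite !inE ?eqxx.
by rewrite inE => /eqP ->; rewrite tnth3_0; apply: supp_on_var; rewrite !inE eqxx orbT.
Qed.

(** This identity allows passing from [Q] back to [q]. It is used with the coordinates themselves,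
    and with x = 0 to isolate p(p(x1)). *)
Lemma conj_poly_comp b p q (x y : {mpoly k[3]}) : b != 0 ->
  (forall m, m \in msupp p -> m i1 = 0%N /\ m i2 = 0%N) ->
  conj_poly b p q \mPo [tuple b *: x + (p \mPo [tuple y; 0; 0]); y; 0] =
  b *: (q \mPo [tuple y; x; 0]) + (p \mPo [tuple b *: x + (p \mPo [tuple y; 0; 0]); 0; 0]).
Proof.
move=> b0 p12; rewrite comp_mpolyD comp_mpolyZ (comp_on_var0 _ _ _ p12).
rewrite comp_mpolyA endo_comp3 comp_mpoly_var tnth3_1 comp_mpoly0.
rewrite comp_mpolyZ comp_mpolyB comp_mpolyA endo_comp3 !comp_mpoly_var.
rewrite tnth3_0 tnth3_1.
rewrite (comp_mpoly0 [tuple b *: x + (p \mPo [tuple y; 0; 0]); y; 0]).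
by rewrite addrK scalerA (mulVf b0) scale1r.
Qed.

(** The dominant monomial of Q has no a priori degree bound, so th has to be realised otherwise. If
    th = e, it is an integer at most d. If th > e, a monomial of q of the same weight is used, with
    the roles of x1 and x2 exchanged. If th < e, the monomial of Q is small after all. *)
Lemma conj_poly_degree d e b p q th : b != 0 -> (0 < d)%N -> (e <= d)%N ->
  (forall m, m \in msupp q -> m i2 = 0%N /\ (m i0 + m i1 <= d)%N) ->
  (forall m, m \in msupp p -> [/\ m i1 = 0%N, m i2 = 0%N & (m i0 <= e)%N]) ->
  ((0 < e)%N -> exists2 m, m \in msupp p & m i0 = e) -> 1 < th ->
  (forall m, m \in msupp (conj_poly b p q) -> (m i0)%:R * th + (m i1)%:R <= th ^+ 2) ->
  (exists2 m, m \in msupp (conj_poly b p q) & (m i0)%:R * th + (m i1)%:R = th ^+ 2) ->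
  quadratic_degree d th.
Proof.
move=> b0 d0 ed qd pe pE th1 Qth [mQ mQQ mQE].
have th0 : 0 < th by exact: lt_trans th1.
have p12 m : m \in msupp p -> m i1 = 0%N /\ m i2 = 0%N by move=> /pe[].
have q2 m : m \in msupp q -> m i2 = 0%N by move=> /qd[].
have Q2 m : m \in msupp (conj_poly b p q) -> m i2 = 0%N.
  by move=> mQ'; apply: (supp_conj_poly p12 q2 mQ'); rewrite !inE !ord3_eq.
have [->|/eqP] := eqVneq th e%:R; first exact: quadratic_degree_nat.
rewrite -/(~ _) => /eqP; rewrite neq_lt => /orP[the|eth]; last first.
  (* X dominates p(Y), so Q(X,Y) and q(x1,x2) reach the same maximal weight. *)
  pose mu := tnth [tuple 1; th; 1]; pose nu := tnth [tuple th; 1; 1].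
  have pw m : m \in msupp p -> wdeg nu m < th ^+ 2.
    move=> mp; have [m1 m2 me] := pe m mp; rewrite wdeg3 m1 m2 !mulr0 !addr0 expr2.
    by rewrite ltr_pM2l // (le_lt_trans _ eth) // ler_nat.
  have qle : wle mu (th ^+ 2) q.
    pose G : endo k 3 := [tuple b *: 'X_i1 + (p \mPo [tuple 'X_i0; 0; 0]); 'X_i0; 0].
    have -> : q = b^-1 *: (conj_poly b p q \mPo G -
        (p \mPo [tuple b *: 'X_i1 + (p \mPo [tuple 'X_i0; 0; 0]); 0; 0])).
      rewrite conj_poly_comp // comp_var01_id // addrK scalerA (mulVf b0) scale1r.
      by [].
    have Gw : wle mu th (b *: 'X_i1 + (p \mPo [tuple 'X_i0; 0; 0])).
      apply: supp_inD; first by apply: supp_inZ; apply: supp_inX; rewrite wdeg1 /mu tnth3.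
      rewrite comp_var0_id // => m mp; have [m1 m2 me] := pe m mp.
      rewrite wdeg3 m1 m2 !mulr0 !addr0 mul1r; apply: le_trans (ltW eth); by rewrite ler_nat.
    have X0w : wle mu 1 ('X_i0 : {mpoly k[3]}) by apply: supp_inX; rewrite wdeg1 /mu tnth3.
    apply: supp_inZ; apply: supp_inB.
      apply: (@wle_comp _ _ _ _ nu) => [m mQ'|]; last first.
        by elim/ord3_ind; rewrite /nu !tnth3 //; apply: supp_in0.
      by rewrite wdeg3 (Q2 m mQ') mulr0 addr0 mul1r mulrC; apply: Qth.
    apply: (@wle_comp _ _ _ _ nu) => [m /pw/ltW //|].
    by elim/ord3_ind; rewrite /nu !tnth3 //; apply: supp_in0.
  (* If [q] stayed below th^2, so would its contribution to Q, and [p] is below th^2 too; this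
     contradicts the choice of [mQ]. *)
  have [m mq mE] : exists2 m, m \in msupp q & wdeg mu m = th ^+ 2.
    apply: contrapT => H.
    have ql : lead_at mu (th ^+ 2) q 0.
      apply: lead_at_lt => m mq; rewrite lt_neqAle; apply/andP; split; last exact: qle.
      by apply/eqP => E; apply: H; exists m.
    pose Y : endo k 3 := [tuple 'X_i1; b^-1 *: ('X_i0 - (p \mPo [tuple 'X_i1; 0; 0])); 0].
    have Ye : forall j, lead_at nu (mu j) (tnth Y j) (wpart nu (mu j) (tnth Y j)).
      elim/ord3_ind; apply: lead_at_wpart; rewrite /mu !tnth3.
      - by apply: supp_inX; rewrite wdeg1 /nu tnth3.
      - apply: supp_inZ; apply: supp_inB; first by apply: supp_inX; rewrite wdeg1 /nu tnth3.
        apply: (@wle_comp _ _ _ _ (tnth [tuple 1; 1; 1])) => [m mp|].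
          have [m1 m2 me] := pe m mp; rewrite wdeg3 m1 m2 !mulr0 !addr0 mul1r.
          by apply: le_trans (ltW eth); rewrite ler_nat.
        elim/ord3_ind; rewrite !tnth3; try exact: supp_in0.
        by apply: supp_inX; rewrite wdeg1 /nu tnth3.
      exact: supp_in0.
    have Ql : lead_at nu (th ^+ 2) (conj_poly b p q) 0.
      rewrite -[X in lead_at _ _ _ X]addr0 -{1}(scaler0 _ b); apply: lead_atD.
        pose H' := [tuple wpart nu (mu j) (tnth Y j) | j < 3].
        apply: lead_atZ; rewrite -[X in lead_at _ _ _ X](comp_mpoly0 H'); apply: lead_at_comp ql _ => j.
        by rewrite [tnth H' j]tnth_mktuple; apply: Ye.
      by apply: lead_at_lt => m /pw.
    have := Ql.2 mQ; rewrite subr0 => /(_ mQQ); rewrite wdeg3 (Q2 mQ mQQ) mulr0 addr0 mul1r.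
    by rewrite mulrC mQE ltxx.
  have [m2 md] := qd m mq; move: mE; rewrite wdeg3 m2 mulr0 addr0 mul1r => mE.
  exists (m i1), (m i0), 1%N; split=> //; first by rewrite addnC.
  by apply: quadratic_valueE => //; rewrite -mE; ring.
(* p(p(x1)) has degree e^2, too much for Q to cancel, so q has a term x1^(e^2). *)
have e0 : (0 < e)%N by rewrite -(ltr_nat R); apply: lt_trans the.
(* From x th + y <= th^2 and x <= th < e follows x e + y <= th e < e^2: substituting (p(x1), x1)
   into Q stays below degree e^2. *)
have Qlt m : m \in msupp (conj_poly b p q) -> (m i0 * e + m i1 < e * e)%N.
  move=> /Qth h; rewrite -(ltr_nat R) natrD !natrM; move: h the th0.
  have := ler0n R (m i0); have := ler0n R (m i1).
  move: (m i0)%:R (m i1)%:R (e%:R : R) => x y E y0 x0 h thE th0.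
  have xth : x <= th by rewrite -(ler_pM2r th0) -expr2; lra.
  have h1 : x * E + y <= th * E.
    have : 0 <= (th - x) * (E - th) by rewrite mulr_ge0 // subr_ge0 // ltW.
    nra.
  apply: le_lt_trans h1 _; rewrite ltr_pM2r //; exact: lt_trans thE.
suff ee : (e * e <= d)%N.
  (* With e^2 <= d the dominant monomial itself is admissible: m0 + m1 <= m0 e + m1 < e^2. *)
  have mQd := Qlt mQ mQQ; apply: (@quadratic_degree_monomial _ _ 1 _ mQ) => //; last by rewrite mulr1.
  apply: ltnW; apply: leq_trans ee; apply: leq_ltn_trans mQd.
  by rewrite leq_add2r leq_pmulr.
pose mu := tnth [tuple (1 : R); 1; 1]; pose nu := tnth [tuple (e%:R : R); 1; 1].
have pmu : wle mu e%:R p.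
  move=> m mp; have [m1 m2 me] := pe m mp.
  by rewrite wdeg3 m1 m2 !mulr0 !addr0 mul1r ler_nat.
pose hp := wpart mu e%:R p.
have [mp mpp mpe] := pE e0; have [mp1 mp2 _] := pe mp mpp.
have mphp : mp \in msupp hp.
  by rewrite mem_wpart mpp wdeg3 mp1 mp2 !mulr0 !addr0 mul1r mpe eqxx.
pose P : endo k 3 := [tuple p; 0; 0]; pose HP : endo k 3 := [tuple hp; 0; 0].
have PHP j : lead_at mu (nu j) (tnth P j) (tnth HP j) .
  move: j; elim/ord3_ind; rewrite /nu !tnth3; try exact: lead_at0.
  exact: lead_at_wpart.
have pnu : wle nu (e%:R * e%:R) p.
  move=> m mp'; have [m1 m2 me] := pe m mp'.
  by rewrite wdeg3 m1 m2 !mulr0 !addr0 -!natrM ler_nat leq_mul2l me orbT.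
have Lpp := lead_at_comp (lead_at_wpart pnu) PHP.
(* The part of p o p in degree e^2 is a nonzero polynomial in the nonconstant [hp], hence
   nonzero. *)
have pp0 : wpart nu (e%:R * e%:R) p \mPo HP != 0.
  have hinj : inj_on [set i0]%SET HP.
    apply: (@inj_on_single _ _ _ i0 i0); exists mp; first by rewrite tnth3.
    by rewrite mpe -lt0n.
  apply: hinj.
    move=> m; rewrite mem_wpart => /andP[_ /p12[m1 m2]].
    by elim/ord3_ind; rewrite !inE ?eqxx.
  rewrite -msupp_eq0; have : mp \in msupp (wpart nu (e%:R * e%:R) p).
    by rewrite mem_wpart mpp wdeg3 mp1 mp2 mpe !mulr0 !addr0 eqxx.
  by case: (msupp _).
pose K : endo k 3 := [tuple 'X_i0; 0; 0].
pose W : endo k 3 := [tuple p; 'X_i0; 0].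
(* That is, Q(p(x1), x1) = b q(x1, 0) + p(p(x1)): the left side has degree below e^2, so q(x1, 0)
   must cancel the top of p(p(x1)). *)
have WE : conj_poly b p q \mPo W = b *: (q \mPo K) + (p \mPo P).
  have := @conj_poly_comp b p q 0 'X_i0 b0 p12.
  by rewrite (comp_var0_id p12) scaler0 add0r.
have LQ : lead_at mu (e%:R * e%:R) (conj_poly b p q \mPo W) 0.
  rewrite -[X in lead_at _ _ _ X](comp_mpoly0 [tuple wpart mu (nu j) (tnth W j) | j < 3]).
  apply: (@lead_at_comp _ _ _ _ nu).
    apply: lead_at_lt => m mQ'; rewrite wdeg3 (Q2 m mQ') mulr0 addr0 mul1r -natrM -natrM -natrD.
    by rewrite ltr_nat mulnC Qlt.
  move=> j; rewrite [X in lead_at _ _ _ X]tnth_mktuple; apply: lead_at_wpart; move: j.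
  elim/ord3_ind; rewrite /nu !tnth3 //; last exact: supp_in0.
  by apply: supp_inX; rewrite wdeg1 /mu tnth3.
have Lq : lead_at mu (e%:R * e%:R) (q \mPo K) (b^-1 *: (0 - (wpart nu (e%:R * e%:R) p \mPo HP))).
  have -> : q \mPo K = b^-1 *: ((conj_poly b p q \mPo W) - (p \mPo P)).
    by rewrite WE addrK scalerA (mulVf b0) scale1r.
  apply: lead_atZ; apply: lead_atD => //; rewrite -!scaleN1r; exact: lead_atZ.
have : b^-1 *: (0 - (wpart nu (e%:R * e%:R) p \mPo HP)) != 0.
  by rewrite sub0r scaler_eq0 oppr_eq0 negb_or invr_eq0 b0.
rewrite -msupp_eq0; case E : (msupp _) => [//|m s] _.
have mL : m \in msupp (b^-1 *: (0 - (wpart nu (e%:R * e%:R) p \mPo HP))) by rewrite E mem_head.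
have mw := Lq.1 m mL.
have mqK : m \in msupp (q \mPo K).
  by move: mL; rewrite !mcoeff_msupp (lead_at_coeff m Lq); case: ifP => //; rewrite eqxx.
have [m' m'q] := mdeg_comp mqK; have [m'2 m'd] := qd m' m'q.
have K1 : (degree K <= 1)%N.
  by apply: degree_le; elim/ord3_ind => l; rewrite !tnth3 ?msupp0 // msuppX inE => /eqP ->; rewrite mdeg1.
have -> : (e * e = mdeg m)%N.
  apply/eqP; rewrite -(eqr_nat R) natrM -mw wdeg3 !mul1r -!natrD mdegE sum3.
  by [].
rewrite [mdeg m']mdegE sum3 m'2 addr0 => h; apply: leq_trans h _.
by apply: leq_trans m'd; rewrite -[leqRHS]muln1 leq_mul2l K1 orbT.
Qed.

(** [h'] passes to the coordinates (X, Y, x3), where the map has the shape treated by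
    [growth_shift]. The conjugation may raise the degree, so the bound on th comes from
    [conj_poly_degree]. *)
Lemma growth_cycle2 d a b c s p q :
  a != 0 -> b != 0 -> c != 0 ->
  is_automorphism [tuple b *: 'X_i1 + p; a *: 'X_i2 + q; c *: 'X_i0 + s%:MP] -> (0 < d)%N ->
  (forall m, m \in msupp q -> m i2 = 0%N /\ (m i0 + m i1 <= d)%N) ->
  (forall m, m \in msupp p -> [/\ m i1 = 0%N, m i2 = 0%N & (m i0 <= d)%N]) ->
  exists th, quadratic_degree d th /\
    growth [tuple b *: 'X_i1 + p; a *: 'X_i2 + q; c *: 'X_i0 + s%:MP] th.
Proof.
move=> a0 b0 c0 aF d0 qd pd.
have p12 m : m \in msupp p -> m i1 = 0%N /\ m i2 = 0%N by move=> /pd[].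
have q2 m : m \in msupp q -> m i2 = 0%N by move=> /qd[].
pose Q := conj_poly b p q.
have Q2 m : m \in msupp Q -> m i2 = 0%N.
  by move=> mQ'; apply: (supp_conj_poly p12 q2 mQ'); rewrite !inE !ord3_eq.
have [e [pe pE]] := ex_max_exponent p i0.
have [th [th1 Qth QE]] := ex_dominant_root R 1 (msupp Q).
exists th; split.
  have [th1'|th1'] := ltP 1 th; last first.
    have -> : th = 1%:R by apply/eqP; rewrite eq_le th1 th1'.
    exact: quadratic_degree_nat.
  have ed : (e <= d)%N.
    case: e {pe} pE => // e /(_ isT)[m mp <-]; by have [_ _] := pd m mp.
  apply: (@conj_poly_degree d e b p q th) => //.
  - by move=> m mp; have [m1 m2] := p12 m mp; split=> //; apply: pe.
  - by move=> m /Qth; rewrite mulr1.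
  by have [m mQ] := QE th1'; rewrite mulr1; exists m.
pose h : endo k 3 := [tuple 'X_i1; b^-1 *: ('X_i0 - (p \mPo [tuple 'X_i1; 0; 0])); 'X_i2].
pose h' : endo k 3 := [tuple b *: 'X_i1 + p; 'X_i0; 'X_i2].
apply: (@growth_transport _ _ h h' _
  [tuple (a * b) *: 'X_i2 + Q; 1 *: 'X_i0 + 0%:MP; c *: 'X_i1 + s%:MP]) => //.
- rewrite endo_comp3 comp_mpolyZ comp_mpolyB comp_mpolyA endo_comp3 !comp_mpoly_var !comp_mpoly0 !tnth3.
  by rewrite comp_var0_id // addrK scalerA (mulVf b0) scale1r endo_id3.
- rewrite endo_comp3 comp_scale_var_add !comp_mpoly_var !tnth3 comp_on_var0 //.
  by rewrite scalerA (mulfV b0) scale1r subrK endo_id3.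
- have -> : endo_comp [tuple (a * b) *: 'X_i2 + Q; 1 *: 'X_i0 + 0%:MP; c *: 'X_i1 + s%:MP] h' =
      [tuple (a * b) *: 'X_i2 + (b *: q + (p \mPo [tuple b *: 'X_i1 + p; 0; 0]));
             b *: 'X_i1 + p; c *: 'X_i0 + s%:MP].
    rewrite endo_comp3 !comp_scale_var_add !tnth3 !comp_mpolyC mpolyC0 addr0 scale1r.
    have := @conj_poly_comp b p q 'X_i1 'X_i0 b0 p12.
    rewrite (comp_var0_id p12) (comp_var01_id q2) => <-.
    by rewrite /h' (comp_on_var01 _ _ _ Q2).
  rewrite endo_comp3 !comp_mpoly_var !tnth3 comp_mpolyZ comp_mpolyB comp_mpolyA endo_comp3.
  rewrite !comp_mpoly_var !comp_mpoly0 !tnth3 addrA addrK.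
  by rewrite scalerDr !scalerA mulrCA (mulVf b0) mulr1 scale1r.
move=> aG; apply: (@growth_shift _ _ (a * b) 1 c 0 s Q th) => //.
- by rewrite mulf_neq0.
- exact: oner_neq0.
- by move=> m /Qth; rewrite mulr1.
by move=> /QE[m mQ]; rewrite mulr1; exists m.
Qed.

End Cycle2.

(** * Assembling the six permutations *)

Section Main.
Variables (R : realType) (k : fieldType).
Implicit Types (a b c s : k) (p q : {mpoly k[3]}) (d e : nat) (th : R).

Lemma quadratic_degree_max1 d e : (0 < d)%N -> (e <= d)%N -> quadratic_degree d ((maxn 1 e)%:R : R).
Proof. by move=> d0 ed; apply: quadratic_degree_nat; rewrite geq_max d0. Qed.

(** For constant [p] the weight e of x2 would be 0 and [growth_main] does not apply; then x2 evolves
    by itself and [growth_skew] gives the degree of [q] in x1, or 1 if that is 0. *)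
Lemma growth_swap02 d a b c s p q :
  a != 0 -> b != 0 -> c != 0 ->
  is_automorphism [tuple a *: 'X_i2 + q; b *: 'X_i1 + p; c *: 'X_i0 + s%:MP] -> (0 < d)%N ->
  (forall m, m \in msupp q -> m i2 = 0%N /\ (m i0 + m i1 <= d)%N) ->
  (forall m, m \in msupp p -> [/\ m i1 = 0%N, m i2 = 0%N & (m i0 <= d)%N]) ->
  exists th, quadratic_degree d th /\
    growth [tuple a *: 'X_i2 + q; b *: 'X_i1 + p; c *: 'X_i0 + s%:MP] th.
Proof.
move=> a0 b0 c0 aF d0 qd pd.
have q2 m : m \in msupp q -> m i2 = 0%N by move=> /qd[].
have [[|e] [pe pE]] := ex_max_exponent p i0.
  have [E [qE1 qE2]] := ex_max_exponent q i0.
  have Ed : (E <= d)%N.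
    case: E {qE1} qE2 => // E /(_ isT)[m mq <-]; have [_] := qd m mq.
    exact: leq_trans (leq_addr _ _).
  have p0 : p = (p@_0%MM)%:MP.
    apply: supp_on0_const => m mp j _; have [m1 m2 _] := pd m mp; have m0 := pe m mp.
    by move: j; elim/ord3_ind => //; apply/eqP; rewrite -leqn0.
  exists (maxn 1 E)%:R; split; first exact: quadratic_degree_max1.
  apply: (@growth_skew _ _ _ true a c b p@_0%MM (maxn 1 E) s%:MP q) => //=; rewrite ?tnth3 //.
  - by rewrite -p0.
  - by move=> m mq; split; [apply: q2|rewrite leq_max qE1 ?orbT].
  - move=> m /(@supp_inC _ _ (eq^~ 0%MM) s erefl) ->.
    by rewrite !mnm0E.
  - by rewrite leq_max.
  move=> E1; have [m mq mE] : exists2 m, m \in msupp q & m i0 = E by apply: qE2; lia.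
  by exists m => //; rewrite mE; apply/esym/maxn_idPr; lia.
have [th [th1 qth qE]] := ex_dominant_root R e.+1 (msupp q).
have [mp mpp mpe] := pE isT.
have ed : (e.+1 <= d)%N by rewrite -mpe; have [_ _] := pd mp mpp.
exists th; split.
  have [/qE[m mq mE]|th1'] := ltP 1 th; last first.
    have -> : th = 1%:R by apply/eqP; rewrite eq_le th1 th1'.
    exact: quadratic_degree_nat.
  have [_ md] := qd m mq.
  by apply: (quadratic_degree_monomial (lt_le_trans ltr01 th1) md ed).
apply: (@growth_main _ _ a b c e.+1) => //; last by exists mp.
by move=> m mp'; have [m1 m2 _] := pd m mp'; split=> //; apply: pe.
Qed.

Lemma permuted_triangular_growth d (tau : endo k 3) (s : {perm 'I_3}) : (0 < d)%N ->
  is_triangular tau -> is_automorphism tau -> (degree tau <= d)%N ->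
  is_automorphism [tuple tnth tau (s i) | i < 3] ->
  exists th, quadratic_degree d th /\ growth [tuple tnth tau (s i) | i < 3] th.
Proof.
move=> d0 ttau atau taud.
have [c [r [c0 rT E0]]] := triangular_automorphism_shape i0 ttau atau.
have [b [p [b0 pT E1]]] := triangular_automorphism_shape i1 ttau atau.
have [a [q [a0 qT E2]]] := triangular_automorphism_shape i2 ttau atau.
have {rT} : r = (r@_0%MM)%:MP.
  apply: supp_on0_const; apply: supp_onW rT; apply/fintype.subsetP => j.
  by rewrite !inE inordK.
move: (r@_0%MM) => s0 rE; rewrite {r}rE in E0.
have p12 m : m \in msupp p -> m i1 = 0%N /\ m i2 = 0%N.
  by move=> mp; split; apply: (pT m mp); rewrite inE !inordK.
have q2 m : m \in msupp q -> m i2 = 0%N.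
  by move=> mq; apply: (qT m mq); rewrite inE !inordK.
have pd m : m \in msupp p -> [/\ m i1 = 0%N, m i2 = 0%N & (m i0 <= d)%N].
  move=> mp; have [m1 m2] := p12 m mp; split=> //.
  have : m \in msupp (tnth tau i1).
    by rewrite E1 mem_scale_var_add ?mp ?orbT // => m' /p12[].
  by move=> /mdeg_le_degree/leq_trans/(_ taud); rewrite mdegE sum3 m1 m2 !addr0.
have qd m : m \in msupp q -> m i2 = 0%N /\ (m i0 + m i1 <= d)%N.
  move=> mq; have m2 := q2 m mq; split=> //.
  have : m \in msupp (tnth tau i2) by rewrite E2 mem_scale_var_add ?mq ?orbT.
  by move=> /mdeg_le_degree/leq_trans/(_ taud); rewrite mdegE sum3 m2 !addr0.
have -> : [tuple tnth tau (s i) | i < 3] =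
    [tuple tnth tau (s i0); tnth tau (s i1); tnth tau (s i2)].
  by apply: eq_from_tnth; elim/ord3_ind; rewrite tnth_mktuple !tnth3.
have s01 : s i0 != s i1 by rewrite (inj_eq perm_inj) ord3_eq.
have s02 : s i0 != s i2 by rewrite (inj_eq perm_inj) ord3_eq.
have s12 : s i1 != s i2 by rewrite (inj_eq perm_inj) ord3_eq.
move: (s i0) (s i1) (s i2) s01 s02 s12 => j0 j1 j2.
(* Six goals survive, ordered lexicographically by (s 0, s 1, s 2): the identity, the transposition
   of x2 and x3, that of x1 and x2, the two 3-cycles, and the transposition of x1 and x3. *)
move: j0 j1 j2; do 3!elim/ord3_ind; rewrite ?eqxx // => _ _ _; rewrite ?E0 ?E1 ?E2 => aF.
- exists 1; split; first exact: (quadratic_degree_nat _ d0).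
  exact: growth_triangular.
- have [e [qe qE]] := ex_max_exponent q i1.
  have ed : (e <= d)%N.
    case: e {qe} qE => // e /(_ isT)[m mq <-]; have [_] := qd m mq.
    exact: leq_trans (leq_addl _ _).
  exists (maxn 1 e)%:R; split; first exact: quadratic_degree_max1.
  apply: (@growth_skew _ _ _ false a b c s0 (maxn 1 e) p q) => //=; rewrite ?tnth3 //.
  - by move=> m mq; split; [apply: q2|rewrite leq_max qe ?orbT].
  - by rewrite leq_max.
  move=> e1; have [m mq mE] : exists2 m, m \in msupp q & m i1 = e by apply: qE; lia.
  by exists m => //; rewrite mE; apply/esym/maxn_idPr; lia.
- have [e [pe pE]] := ex_max_exponent p i0.
  have ed : (e <= d)%N.
    by case: e {pe} pE => // e /(_ isT)[m mp <-]; have [_ _] := pd m mp.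
  exists (maxn 1 e)%:R; split; first exact: quadratic_degree_max1.
  apply: (@growth_henon _ _ a b c s0 (maxn 1 e) p q) => //.
  - by rewrite leq_max.
  - by move=> m mp; have [m1 m2] := p12 m mp; rewrite leq_max pe ?orbT.
  move=> e1; have [m mp mE] : exists2 m, m \in msupp p & m i0 = e by apply: pE; lia.
  by exists m => //; rewrite mE; apply/esym/maxn_idPr; lia.
- exact: growth_cycle2.
- exact: growth_cycle1.
exact: growth_swap02.
Qed.

Lemma affine_triangular_growth d (f : endo k 3) : (0 < d)%N ->
  is_automorphism f -> is_affine_triangular f -> (degree f <= d)%N ->
  exists th, quadratic_degree d th /\ growth f th.
Proof.
move=> d0 af atf fd.
have [h [h' [s [tau [hh' h'h ttau atau [taud E]]]]]] := affine_triangular_normal_form af atf.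
have aF : is_automorphism [tuple tnth tau (s i) | i < 3].
  rewrite -E; apply: is_automorphism_comp; first by exists h.
  by apply: is_automorphism_comp af _; exists h'.
have [th [dth gth]] := permuted_triangular_growth d0 ttau atau (leq_trans taud fd) aF.
exists th; split; first exact: dth.
apply: (growth_transport hh' h'h) af (fun=> gth).
rewrite -E -!(endo_compA h') -(endo_compA f) hh' endo_compf1 endo_compA hh'.
by rewrite endo_comp1f.
Qed.

End Main.

(** * The two explicit families *)

Section Examples.
Variables (R : realType) (k : fieldType).
Implicit Types (a b c d : nat).

Definition mnm01 a b : 'X_{1..3} := [multinom tnth [tuple a; b; 0%N] i | i < 3].

Lemma mnm01E a b : (mnm01 a b i0 = a) * (mnm01 a b i1 = b) * (mnm01 a b i2 = 0%N).
Proof. by do !split; rewrite mnmE !tnth3. Qed.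

Lemma mnm01_prod a b : 'X_i0 ^+ a * 'X_i1 ^+ b = 'X_[mnm01 a b] :> {mpoly k[3]}.
Proof.
rewrite !mpolyXn -mpolyXD; congr 'X_[_]; apply/mnmP.
by elim/ord3_ind; rewrite mnmDE !mulmnE !mnm1E !ord3_eq ?eqxx !mnm01E; lia.
Qed.

Lemma first_automorphismE a b c : first_automorphism k a b c =
  [tuple 1 *: 'X_i2 + 'X_[mnm01 a b]; 1 *: 'X_i1 + 'X_[mnm01 c 0]; 1 *: 'X_i0 + 0%:MP].
Proof. by rewrite -!mnm01_prod !scale1r mpolyC0 addr0 expr0 mulr1. Qed.

Lemma second_automorphismE a b c : second_automorphism k a b c =
  [tuple 1 *: 'X_i2 + 'X_[mnm01 a (b * c)]; 1 *: 'X_i0 + 0%:MP; 1 *: 'X_i1 + 0%:MP].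
Proof. by rewrite -!mnm01_prod !scale1r mpolyC0 !addr0. Qed.

Lemma comp_mpoly_exp n (p : {mpoly k[n]}) (F : endo k n) r : p ^+ r \mPo F = (p \mPo F) ^+ r.
Proof. exact: rmorphXn. Qed.

Lemma comp_mpoly_mul n (p q : {mpoly k[n]}) (F : endo k n) :
  (p * q) \mPo F = (p \mPo F) * (q \mPo F).
Proof. exact: rmorphM. Qed.

Lemma is_automorphism_first a b c : is_automorphism (first_automorphism k a b c).
Proof.
exists [tuple 'X_i2; 'X_i1 - 'X_i2 ^+ c; 'X_i0 - 'X_i2 ^+ a * ('X_i1 - 'X_i2 ^+ c) ^+ b].
rewrite /first_automorphism /coord !endo_comp3 endo_id3.
rewrite !(comp_mpolyB, comp_mpolyD, comp_mpoly_mul, comp_mpoly_exp, comp_mpoly_var) !tnth3.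
by rewrite !addrK !subrK.
Qed.

Lemma is_automorphism_second a b c : is_automorphism (second_automorphism k a b c).
Proof.
exists [tuple 'X_i1; 'X_i2; 'X_i0 - 'X_i1 ^+ a * 'X_i2 ^+ (b * c)].
rewrite /second_automorphism /coord !endo_comp3 endo_id3.
rewrite !(comp_mpolyB, comp_mpolyD, comp_mpoly_mul, comp_mpoly_exp, comp_mpoly_var) !tnth3.
by rewrite !addrK !subrK.
Qed.

Lemma growth_first a b c : quadratic_value R a b c != 0 ->
  growth (first_automorphism k a b c) (quadratic_value R a b c).
Proof.
move=> q0; have q1 := quadratic_value_ge1 q0; have := is_automorphism_first a b c.
have one0 : 1 != 0 :> k by exact: oner_neq0.
rewrite first_automorphismE; case: c q0 q1 => [|c] q0 q1 aF.
  (* For c = 0 the second component is x2 + 1 and the weight c of x2 vanishes; the value is a,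
     obtained as a skew case. *)
  rewrite quadratic_value0 in q0 *.
  have a0 : (0 < a)%N by rewrite lt0n; apply: contraNneq q0 => ->.
  apply: (@growth_skew _ _ _ true 1 1 1 1 a 0%:MP 'X_[mnm01 a b]) => //=; rewrite ?tnth3 //.
  - by congr (_ + _); rewrite -mnm01_prod !expr0 mulr1 mpolyC1.
  - by move=> m /mem_msuppXP <-; rewrite !mnm01E.
  - by move=> m; rewrite mpolyC0 msupp0.
  by move=> _; exists (mnm01 a b); [rewrite msuppX mem_head|rewrite mnm01E].
have E := quadratic_value_root R a b c.+1.
apply: (@growth_main _ _ 1 1 1 c.+1) => //.
- by move=> m /mem_msuppXP <-; rewrite !mnm01E.
- by move=> m /mem_msuppXP <-; rewrite !mnm01E.
- by exists (mnm01 c.+1 0); [rewrite msuppX mem_head|rewrite mnm01E].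
- by move=> m /mem_msuppXP <-; rewrite !mnm01E E.
by move=> _; exists (mnm01 a b); [rewrite msuppX mem_head|rewrite !mnm01E].
Qed.

Lemma growth_second a b c : quadratic_value R a b c != 0 ->
  growth (second_automorphism k a b c) (quadratic_value R a b c).
Proof.
move=> q0; have q1 := quadratic_value_ge1 q0; have := is_automorphism_second a b c.
have one0 : 1 != 0 :> k by exact: oner_neq0.
have E := quadratic_value_root R a b c.
rewrite second_automorphismE => aF; apply: (@growth_shift _ _ 1 1 1 0 0) => //.
- by move=> m /mem_msuppXP <-; rewrite !mnm01E.
- by move=> m /mem_msuppXP <-; rewrite !mnm01E natrM E.
by move=> _; exists (mnm01 a (b * c)); [rewrite msuppX mem_head|rewrite !mnm01E natrM].
Qed.

Lemma degree_first a b c d : (0 < d)%N -> (a + b <= d)%N -> (c <= d)%N ->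
  (degree (first_automorphism k a b c) <= d)%N.
Proof.
move=> d0 abd cd; rewrite first_automorphismE; apply: degree_le; elim/ord3_ind; rewrite !tnth3.
- apply: supp_inD; first by apply: supp_inZ; apply: supp_inX; rewrite mdeg1.
  by apply: supp_inX; rewrite mdegE sum3 !mnm01E addr0.
- apply: supp_inD; first by apply: supp_inZ; apply: supp_inX; rewrite mdeg1.
  by apply: supp_inX; rewrite mdegE sum3 !mnm01E !addr0.
by apply: supp_affine; rewrite ?mdeg1 ?mdeg0.
Qed.

Lemma affine_triangular_first a b c : is_affine_triangular (first_automorphism k a b c).
Proof.
pose al : endo k 3 := [tuple 'X_i2; 'X_i1; 'X_i0].
exists al, [tuple 'X_i0; 1 *: 'X_i1 + 'X_[mnm01 c 0]; 1 *: 'X_i2 + 'X_[mnm01 a b]]; split.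
- have aal : is_automorphism al.
    by exists al; rewrite endo_comp3 !comp_mpoly_var !tnth3 endo_id3.
  split=> //; apply/eqP; rewrite eqn_leq degree_automorphism // andbT.
  by apply: degree_le; elim/ord3_ind; rewrite !tnth3; apply: supp_inX; rewrite mdeg1.
- apply/is_triangularP; elim/ord3_ind; rewrite !tnth3.
  + by apply: supp_on_var; rewrite inE.
  + apply: supp_inD; first by apply: supp_inZ; apply: supp_on_var; rewrite inE.
    apply: supp_inX; elim/ord3_ind; rewrite !inE !inordK // => _; by rewrite mnm01E.
  apply: supp_inD; first by apply: supp_inZ; apply: supp_on_var; rewrite inE.
  by apply: supp_inX; elim/ord3_ind; rewrite !inE !inordK.
by rewrite endo_comp3 !comp_mpoly_var !tnth3 first_automorphismE !scale1r mpolyC0 addr0.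
Qed.

End Examples.

Theorem theorem1 (R : realType) (k : fieldType) (d : nat) (hd : (2 <= d)%N) :
  [set l : R | exists f : endo k 3,
     [/\ is_automorphism f, is_affine_triangular f, (degree f <= d)%N
       & l = dynamical_degree R f]]
  = [set l : R | exists a b c : nat,
       [/\ (a + b <= d)%N, (c <= d)%N & l = quadratic_value R a b c]]
    `\ (0 : R)
  /\
  (forall a b c : nat, quadratic_value R a b c != 0 ->
     [/\ is_automorphism (first_automorphism k a b c),
         is_automorphism (second_automorphism k a b c),
         dynamical_degree R (first_automorphism k a b c)
           = quadratic_value R a b c
       & dynamical_degree R (second_automorphism k a b c)
           = quadratic_value R a b c]).
Proof.
have d0 : (0 < d)%N by exact: ltnW.
split; last first.
  move=> a b c q0; split.
  - exact: is_automorphism_first.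
  - exact: is_automorphism_second.
  - by apply: growth_dynamical_degree; apply: growth_first.
  - by apply: growth_dynamical_degree; apply: growth_second.
apply/seteqP; split=> l.
  move=> [f [af atf fd ->]].
  have [th [dth gth]] := affine_triangular_growth R d0 af atf fd.
  rewrite (growth_dynamical_degree gth); split; first exact: dth.
  by case: gth => th1 _ _ /= th0; rewrite th0 ler10 in th1.
move=> [[a [b [c [abd cd ->]]]] /= /eqP q0].
(* The first family has degree at most d under the stated bounds, whereas the exponent a + b c of
   the second may exceed d. *)
exists (first_automorphism k a b c); split.
- exact: is_automorphism_first.
- exact: affine_triangular_first.
- exact: degree_first.
- by apply/esym/growth_dynamical_degree/growth_first.
Qed.
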